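(* Let $(A,\mathfrak{m})$ be an Artinian Gorenstein local ring, $\mathfrak{a}$ a proper ideal in $A$ and $M$ a finitely generated $A$-module. Then $$\ell\bigl(G_{\mathfrak{a}}(M)\bigr)\le \ell\Bigl({}^*\operatorname{Hom}_{G_{\mathfrak{a}}(A)}\bigl(G_{\mathfrak{a}}(M),G_{\mathfrak{a}}(A)\bigr)\Bigr).$$
   Context: $G_{\mathfrak{a}}(A)=\bigoplus_{n\ge0}\mathfrak{a}^n/\mathfrak{a}^{n+1}$ and $G_{\mathfrak{a}}(M)=\bigoplus_{n\ge0}\mathfrak{a}^nM/\mathfrak{a}^{n+1}M$. Here $\ell(-)$ denotes length (as a $G_{\mathfrak{a}}(A)$-module). For graded modules $E,F$ over a graded ring $R$, ${}^*\operatorname{Hom}_R(E,F)=\bigoplus_{n\in\mathbb{Z}}\{\text{homogeneous } R\text{-linear maps } E\to F\text{ of degree } n\}$. *)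

(* Defs.v *)
From HB Require Import structures.
From mathcomp Require Import all_boot all_order all_algebra.
From mathcomp Require Import generic_quotient ring_quotient.
From mathcomp Require Import boolp classical_sets functions constructive_ereal.

Set Implicit Arguments.
Unset Strict Implicit.
Unset Printing Implicit Defensive.

Import Order.TTheory GRing.Theory Num.Theory.

Local Open Scope ring_scope.

(* Subsets are boolean predicates; with the axioms of [boolp] every
   proposition [P] has a truth value [`[< P >]], so these are all subsets. *)

Section Modules.
Variables (R : pzRingType) (V : lmodType R).

Definition fin_gen_module : Prop :=
  exists (n : nat) (e : 'I_n -> V),
    forall x, exists c : 'I_n -> R, x = \sum_i c i *: e i.

Definition artinian_module : Prop :=
  forall N : nat -> {pred V},
    (forall i, submod_closed (N i)) ->
    (forall i, {subset N i.+1 <= N i}) ->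
    exists n, forall i, (n <= i)%N -> N i =i N n.

Definition noetherian_module : Prop :=
  forall N : nat -> {pred V},
    (forall i, submod_closed (N i)) ->
    (forall i, {subset N i <= N i.+1}) ->
    exists n, forall i, (n <= i)%N -> N i =i N n.

Definition composition_series (n : nat) (N : nat -> {pred V}) : Prop :=
  [/\ forall i, submod_closed (N i),
      N 0%N =i pred1 0,
      N n =i predT &
      forall i, (i < n)%N ->
        [/\ {subset N i <= N i.+1},
            ~ (N i.+1 =i N i) &
            forall S : {pred V}, submod_closed S ->
              {subset N i <= S} -> {subset S <= N i.+1} ->
              S =i N i \/ S =i N i.+1]].

Definition has_composition_series (n : nat) : bool :=
  `[< exists N, composition_series n N >].

(* The least length of a composition series, [+oo] if there is none. *)
Definition module_length : \bar int :=
  if pselect (exists n, has_composition_series n) is left h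
  then (ex_minn h)%:Z%:E else +oo%E.

Definition injective_module : Prop :=
  forall (N P : lmodType R) (i : {linear N -> P}) (f : {linear N -> V}),
    injective i -> exists g : {linear P -> V}, forall x, g (i x) = f x.

End Modules.

(* There is an injective resolution 0 -> V -> E 0 -> E 1 -> ... -> E n -> 0. *)
Definition finite_injective_dimension (R : pzRingType) (V : lmodType R) :
    Prop :=
  exists (n : nat) (E : nat -> lmodType R) (eps : {linear V -> E 0%N})
         (d : forall i, {linear E i -> E i.+1}),
    [/\ forall i, injective_module (E i),
        injective eps,
        forall y, d 0%N y = 0 <-> exists x, eps x = y,
        forall i y, d i.+1 y = 0 <-> exists x, d i x = y &
        forall i, (n < i)%N -> forall y : E i, y = 0].

Section Rings.
Variable A : comNzRingType.

(* [idealr_closed] ideals are proper. *)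
Definition maximal_ideal (m : {pred A}) : Prop :=
  idealr_closed m /\
  forall J : {pred A}, idealr_closed J -> {subset m <= J} -> J =i m.

Definition local_ring (m : {pred A}) : Prop :=
  maximal_ideal m /\ forall J : {pred A}, maximal_ideal J -> J =i m.

Definition artinian_ring : Prop := artinian_module A^o.

Definition noetherian_ring : Prop := noetherian_module A^o.

Definition gorenstein_local_ring (m : {pred A}) : Prop :=
  [/\ local_ring m, noetherian_ring & finite_injective_dimension A^o].

End Rings.

Section Powers.
Variables (A : comNzRingType) (a : {pred A}) (M : lmodType A).
Implicit Types N : {pred M}.

Definition ideal_mul N : {pred M} :=
  [pred x | `[< exists s : seq (A * M),
      {in s, forall p, (p.1 \in a) && (p.2 \in N)} /\
      x = \sum_(p <- s) p.1 *: p.2 >]].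

(* a^n M, as a(a(...(aM))); for M = A^o this is the ideal a^n. *)
Fixpoint powM (n : nat) : {pred M} :=
  if n is n'.+1 then ideal_mul (powM n') else predT.

Lemma ideal_mulP N x : reflect
  (exists s : seq (A * M),
      {in s, forall p, (p.1 \in a) && (p.2 \in N)} /\
      x = \sum_(p <- s) p.1 *: p.2) (x \in ideal_mul N).
Proof. exact: asboolP. Qed.

Lemma ideal_mul_submod N : submod_closed N -> submod_closed (ideal_mul N).
Proof.
move=> [N0 NL]; split; first by apply/ideal_mulP; exists [::]; rewrite big_nil.
move=> c x y /ideal_mulP[s [hs ->]] /ideal_mulP[t [ht ->]].
apply/ideal_mulP; exists ([seq (p.1, c *: p.2) | p <- s] ++ t); split.
  move=> p; rewrite mem_cat => /orP[/mapP[q qs ->]|/ht//].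
  by have /andP[-> h] /= := hs _ qs; rewrite -[c *: _]addr0 NL.
rewrite big_cat big_map scaler_sumr; congr (_ + _).
by apply: eq_bigr => p _; rewrite !scalerA mulrC.
Qed.

Lemma powM_submod n : submod_closed (powM n).
Proof. by elim: n => [|n IH] //=; apply: ideal_mul_submod. Qed.

HB.instance Definition _ n :=
  GRing.isSubmodClosed.Build A M (powM n) (powM_submod n).

Lemma powM_decr n : {subset powM n.+1 <= powM n}.
Proof.
elim: n => [|n IH] //= x /ideal_mulP[s [hs ->]].
by apply/ideal_mulP; exists s; split=> // p /hs /andP[-> /IH].
Qed.

Definition pow_sub (n : nat) : Type := {x : M | x \in powM n}.
HB.instance Definition _ n := SubChoice.on (pow_sub n).
HB.instance Definition _ n := [SubChoice_isSubLmodule of pow_sub n by <:].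

Definition pow_ker (n : nat) : {pred pow_sub n} :=
  [pred x | val x \in powM n.+1].

Lemma pow_kerE n x : (x \in @pow_ker n) = (val x \in powM n.+1).
Proof. by []. Qed.

Lemma pow_ker_zmod n : zmod_closed (@pow_ker n).
Proof.
split; first by rewrite pow_kerE raddf0 rpred0.
by move=> x y; rewrite !pow_kerE raddfB => ? ?; rewrite rpredB.
Qed.

HB.instance Definition _ n :=
  GRing.isZmodClosed.Build (pow_sub n) (@pow_ker n) (pow_ker_zmod n).

Arguments powM : simpl never.

(* a^n M / a^(n+1) M *)
Definition gr_piece (n : nat) : zmodType :=
  Quotient.quot (@pow_ker n : zmodClosed (pow_sub n)).

End Powers.

Section DirectSum.
Variable V : nat -> zmodType.

Record direct_sum : Type := DirectSum {
  dcomp :> forall n, V n;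
  dcomp_fin : exists N, forall n, (N <= n)%N -> dcomp n = 0 }.

HB.instance Definition _ := gen_eqMixin direct_sum.
HB.instance Definition _ := gen_choiceMixin direct_sum.

Lemma direct_sumP (x y : direct_sum) : (forall n, x n = y n) -> x = y.
Proof.
case: x y => [x hx] [y hy] /= xy.
have exy : x = y by apply: functional_extensionality_dep.
by case: y / exy hy {xy} => hy; congr DirectSum; apply: Prop_irrelevance.
Qed.

Lemma dsum0_fin : exists N, forall n, (N <= n)%N -> (0 : V n) = 0.
Proof. by exists 0%N. Qed.

Lemma dsumD_fin (x y : direct_sum) :
  exists N, forall n, (N <= n)%N -> x n + y n = 0.
Proof.
have [[N hx] [N' hy]] := (dcomp_fin x, dcomp_fin y).
exists (maxn N N') => n; rewrite geq_max => /andP[/hx -> /hy ->].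
exact: addr0.
Qed.

Lemma dsumN_fin (x : direct_sum) : exists N, forall n, (N <= n)%N -> - x n = 0.
Proof. by have [N hx] := dcomp_fin x; exists N => n /hx ->; rewrite oppr0. Qed.

Let dsum0 := DirectSum dsum0_fin.
Let dsumD x y := DirectSum (dsumD_fin x y).
Let dsumN x := DirectSum (dsumN_fin x).

Lemma dsumDA : associative dsumD.
Proof. by move=> x y z; apply: direct_sumP => n /=; rewrite addrA. Qed.
Lemma dsumDC : commutative dsumD.
Proof. by move=> x y; apply: direct_sumP => n /=; rewrite addrC. Qed.
Lemma dsum0D : left_id dsum0 dsumD.
Proof. by move=> x; apply: direct_sumP => n /=; rewrite add0r. Qed.
Lemma dsumND : left_inverse dsum0 dsumN dsumD.
Proof. by move=> x; apply: direct_sumP => n /=; rewrite addNr. Qed.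

HB.instance Definition _ :=
  GRing.isZmodule.Build direct_sum dsumDA dsumDC dsum0D dsumND.

Lemma dcompD x y n : (x + y : direct_sum) n = x n + y n. Proof. by []. Qed.
Lemma dcomp0 n : (0 : direct_sum) n = 0. Proof. by []. Qed.

End DirectSum.

Section Classes.
Variables (A : comNzRingType) (a : {pred A}) (M : lmodType A).
Local Open Scope quotient_scope.

Definition gr_rep n (q : gr_piece a M n) : M := val (repr q).

(* The class in a^n M / a^(n+1) M of an element of a^n M. *)
Definition gr_class n (x : M) : gr_piece a M n :=
  \pi_(gr_piece a M n) (insubd (0 : pow_sub a M n) x).

Lemma gr_rep_pow n (q : gr_piece a M n) : gr_rep q \in powM a n.
Proof. exact: valP. Qed.

Lemma gr_repK n (q : gr_piece a M n) : gr_class n (gr_rep q) = q.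
Proof. by rewrite /gr_class /gr_rep valKd reprK. Qed.

Lemma gr_class_eq n x y : x \in powM a n -> y \in powM a n ->
  (gr_class n x = gr_class n y) <-> (x - y \in powM a n.+1).
Proof.
move=> hx hy; rewrite /gr_class.
have -> : (x - y \in powM a n.+1) =
  (insubd (0 : pow_sub a M n) x - insubd 0 y \in @pow_ker A a M n).
  by rewrite pow_kerE raddfB /= !insubdK.
by rewrite Quotient.idealrBE; split=> [->|/eqP].
Qed.

Lemma gr_classD n x y : x \in powM a n -> y \in powM a n ->
  gr_class n (x + y) = gr_class n x + gr_class n y.
Proof.
move=> hx hy; rewrite /gr_class -[RHS]raddfD; congr (\pi _).
by apply: val_inj; rewrite raddfD /= !insubdK // rpredD.
Qed.

Lemma gr_class0 n x : x \in powM a n.+1 -> gr_class n x = 0.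
Proof.
move=> hx; have h0 : (0 : M) \in powM a n by rewrite rpred0.
have -> : 0 = gr_class n 0 :> gr_piece a M n.
  rewrite /gr_class -[LHS](raddf0 \pi_(gr_piece a M n)); congr (\pi _).
  by apply: val_inj; rewrite insubdK.
by apply/gr_class_eq => //; [exact: powM_decr|rewrite subr0].
Qed.

Lemma gr_class_sum n (I : Type) (s : seq I) (P : pred I) (F : I -> M) :
  (forall i, P i -> F i \in powM a n) ->
  gr_class n (\sum_(i <- s | P i) F i) = \sum_(i <- s | P i) gr_class n (F i).
Proof.
move=> hF; elim: s => [|i s IH]; first by rewrite !big_nil gr_class0 ?rpred0.
rewrite !big_cons; case: ifP => // Pi; rewrite gr_classD ?IH ?hF //.
by rewrite rpred_sum.
Qed.

Lemma powMZ i j (x : A) (y : M) : x \in @powM A a A^o i -> y \in powM a j ->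
  x *: y \in powM a (i + j).
Proof.
elim: i x => [|i IH] x; first by move=> _; exact: rpredZ.
move=> /ideal_mulP[s [hs ->]] hy; apply/ideal_mulP.
exists [seq (p.1, p.2 *: y) | p <- s]; split.
  by move=> _ /mapP[p /hs/andP[h1 h2] ->] /=; rewrite h1 IH.
rewrite big_map scaler_suml; apply: eq_bigr => p _ /=.
by rewrite scalerA.
Qed.

Lemma powMZ_eq i j n (x : A) (y : M) : (i + j)%N = n ->
  x \in @powM A a A^o i -> y \in powM a j -> x *: y \in powM a n.
Proof. by move=> <-; apply: powMZ. Qed.

Lemma powMZ_sub i n (x : A) (y : M) : (i <= n)%N ->
  x \in @powM A a A^o i -> y \in powM a (n - i) -> x *: y \in powM a n.
Proof. by move=> hi; apply: powMZ_eq; rewrite subnKC. Qed.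

Lemma gr_rep0 n : gr_rep (0 : gr_piece a M n) \in powM a n.+1.
Proof.
have h0 := gr_class0 (rpred0 (@powM A a M n.+1)).
rewrite -[X in X \in _]subr0; apply/gr_class_eq; rewrite ?gr_rep_pow ?rpred0 //.
by rewrite gr_repK h0.
Qed.

End Classes.

Section Graded.
Variables (A : comNzRingType) (a : {pred A}).

(* The direct sum of the a^n M / a^(n+1) M. *)
Definition gr (M : lmodType A) : Type := direct_sum (gr_piece a M).
HB.instance Definition _ M := GRing.Zmodule.on (gr M).

(* The summand of degree d; it vanishes for d < 0. *)
Definition gr_homog (M : lmodType A) (d : int) : {pred gr M} :=
  [pred x : gr M | `[< forall n, x n != 0 -> n%:Z = d >]].

Section Scale.
Variable M : lmodType A.

Definition gr_scale_comp (x : gr A^o) (y : gr M) n : gr_piece a M n :=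
  \sum_(i < n.+1) gr_class a n ((gr_rep (x i) : A) *: gr_rep (y (n - i)%N)).

Lemma gr_scale_fin x y :
  exists N, forall n, (N <= n)%N -> gr_scale_comp x y n = 0.
Proof.
have [[N hx] [N' hy]] := (dcomp_fin x, dcomp_fin y).
exists (N + N')%N => n hn; apply: big1 => -[i /=]; rewrite ltnS => hi _ /=.
apply: gr_class0; have [Ni|iN] := leqP N i.
  apply: (@powMZ_eq _ _ _ i.+1 (n - i)); first by rewrite addSn subnKC.
    rewrite hx //; exact: gr_rep0.
  exact: gr_rep_pow.
apply: (@powMZ_eq _ _ _ i (n - i).+1); first by rewrite addnS subnKC.
  exact: gr_rep_pow.
rewrite hy ?gr_rep0 // leq_subRL //; apply: leq_trans hn.
by rewrite leq_add2r ltnW.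
Qed.

(* [u] [v] = [u v], where u in a^i, v in a^j M, u v in a^(i+j) M. *)
Definition gr_scale x y : gr M := DirectSum (gr_scale_fin x y).

Lemma gr_scaleE (x : gr A^o) (y : gr M) (u : nat -> A) (v : nat -> M) n :
  (forall i, u i \in @powM A a A^o i) ->
  (forall i, x i = gr_class a i (u i : A^o)) ->
  (forall i, v i \in powM a i) -> (forall i, y i = gr_class a i (v i)) ->
  gr_scale x y n = gr_class a n (\sum_(i < n.+1) u i *: v (n - i)%N).
Proof.
move=> hu xu hv yv; rewrite gr_class_sum; last first.
  move=> [i /=]; rewrite ltnS => hi _ /=.
  apply: powMZ_sub hi (hu _) (hv _).
apply: eq_bigr => -[i /=]; rewrite ltnS => hi _ /=.
set w := gr_rep (y _); have hw : w \in powM a (n - i) by apply: gr_rep_pow.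
have h1 : (gr_rep (x i) : A) *: w \in powM a n.
  exact: (powMZ_sub hi (gr_rep_pow (x i)) hw).
have h2 : u i *: v (n - i)%N \in powM a n.
  exact: (powMZ_sub hi (hu _) (hv _)).
apply/(gr_class_eq h1 h2); rewrite -[X in X - _](subrK (u i *: w)) -addrA.
rewrite -scalerBl -scalerBr; apply: rpredD.
  apply: (@powMZ_eq _ _ _ i.+1 (n - i)); last exact: gr_rep_pow.
    by rewrite addSn subnKC.
  by apply/(@gr_class_eq _ _ A^o); rewrite ?gr_rep_pow // gr_repK xu.
apply: (@powMZ_eq _ _ _ i (n - i).+1) => //.
  by rewrite addnS subnKC.
by apply/gr_class_eq; rewrite ?gr_rep_pow // gr_repK yv.
Qed.

Lemma gr_scaleD x y z : gr_scale x (y + z) = gr_scale x y + gr_scale x z.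
Proof.
apply: direct_sumP => n; rewrite dcompD.
have gP (P : lmodType A) (w : gr P) i : gr_rep (w i) \in powM a i
  by apply: gr_rep_pow.
have gK (P : lmodType A) (w : gr P) i : w i = gr_class a i (gr_rep (w i)).
  by rewrite gr_repK.
rewrite (gr_scaleE n (gP _ x) (gK _ x) (gP _ y) (gK _ y)).
rewrite (gr_scaleE n (gP _ x) (gK _ x) (gP _ z) (gK _ z)).
rewrite (@gr_scaleE x (y + z) _ (fun i => gr_rep (y i) + gr_rep (z i)) n
  (gP _ x) (gK _ x)); first last.
- by move=> i; rewrite dcompD gr_classD ?gr_rep_pow // !gr_repK.
- by move=> i; rewrite rpredD ?gr_rep_pow.
rewrite -gr_classD; last 2 first.
- apply: rpred_sum => -[i /=]; rewrite ltnS => hi _ /=.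
  exact: (powMZ_sub hi (gr_rep_pow (x _)) (gr_rep_pow (y _))).
- apply: rpred_sum => -[i /=]; rewrite ltnS => hi _ /=.
  exact: (powMZ_sub hi (gr_rep_pow (x _)) (gr_rep_pow (z _))).
by congr gr_class; rewrite -big_split; apply: eq_bigr => i _; rewrite scalerDr.
Qed.

Lemma gr_scaleDl x x' y : gr_scale (x + x') y = gr_scale x y + gr_scale x' y.
Proof.
apply: direct_sumP => n; rewrite dcompD.
have gP (P : lmodType A) (w : gr P) i : gr_rep (w i) \in powM a i
  by apply: gr_rep_pow.
have gK (P : lmodType A) (w : gr P) i : w i = gr_class a i (gr_rep (w i)).
  by rewrite gr_repK.
rewrite (gr_scaleE n (gP _ x) (gK _ x) (gP _ y) (gK _ y)).
rewrite (gr_scaleE n (gP _ x') (gK _ x') (gP _ y) (gK _ y)).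
rewrite (@gr_scaleE (x + x') y (fun i => gr_rep (x i) + gr_rep (x' i)) _ n
  _ _ (gP _ y) (gK _ y)); first last.
- by move=> i; rewrite dcompD gr_classD ?gr_rep_pow // !gr_repK.
- by move=> i; exact: (rpredD (gr_rep_pow (x i)) (gr_rep_pow (x' i))).
rewrite -gr_classD; last 2 first.
- apply: rpred_sum => -[i /=]; rewrite ltnS => hi _ /=.
  exact: (powMZ_sub hi (gr_rep_pow (x _)) (gr_rep_pow (y _))).
- apply: rpred_sum => -[i /=]; rewrite ltnS => hi _ /=.
  exact: (powMZ_sub hi (gr_rep_pow (x' _)) (gr_rep_pow (y _))).
by congr gr_class; rewrite -big_split; apply: eq_bigr => i _; rewrite scalerDl.
Qed.

End Scale.

Lemma gr_one_pow n : (if n == 0%N then 1 else 0 : A) \in @powM A a A^o n.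
Proof. by case: n => [|n] //; exact: (rpred0 (@powM A a A^o n.+1)). Qed.

Lemma gr_one_fin : exists N, forall n, (N <= n)%N ->
  gr_class a n ((if n == 0%N then 1 else 0 : A) : A^o) = 0.
Proof.
exists 1%N => -[|n] //= _; apply: gr_class0.
exact: (rpred0 (@powM A a A^o n.+2)).
Qed.

Definition gr_one : gr A^o := DirectSum gr_one_fin.

Lemma gr_scale1 (M : lmodType A) (y : gr M) : gr_scale gr_one y = y.
Proof.
apply: direct_sumP => n; rewrite (gr_scaleE n gr_one_pow _
  (fun i => gr_rep_pow (y i)) (fun i => esym (gr_repK (y i)))) //.
rewrite big_ord_recl /= scale1r subn0 big1 ?addr0 ?gr_repK //.
by move=> i _; rewrite scale0r.
Qed.

Lemma sum_triangle (V : zmodType) (F : nat -> nat -> nat -> V) n :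
  \sum_(i < n.+1) \sum_(j < i.+1) F j (i - j)%N (n - i)%N =
  \sum_(j < n.+1) \sum_(k < (n - j).+1) F j k (n - j - k)%N.
Proof.
transitivity
  (\sum_(i < n.+1) \sum_(j < n.+1 | (j <= i)%N) F j (i - j)%N (n - i)%N).
  apply: eq_bigr => -[i hi] _ /=.
  exact: (big_ord_widen _ (fun j => F j (i - j)%N (n - i)%N)).
rewrite (exchange_big_dep predT) //=; apply: eq_bigr => -[j /=].
rewrite ltnS => hj _.
rewrite -(big_geq_mkord _ _ predT (fun i => F j (i - j)%N (n - i)%N)) /=.
rewrite -[j in LHS]add0n big_addn subSn // big_mkord; apply: eq_bigr => k _.
by rewrite !add0n addnK subnDA subnAC.
Qed.

Lemma gr_scaleA (M : lmodType A) (x y : gr A^o) (z : gr M) :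
  gr_scale x (gr_scale y z) = gr_scale (gr_scale x y) z.
Proof.
have gP (P : lmodType A) (w : gr P) i : gr_rep (w i) \in powM a i
  by apply: gr_rep_pow.
have gK (P : lmodType A) (w : gr P) i : w i = gr_class a i (gr_rep (w i)).
  by rewrite gr_repK.
have cP (P : lmodType A) (u : gr A^o) (v : gr P) n :
  \sum_(i < n.+1) (gr_rep (u i) : A) *: gr_rep (v (n - i)%N) \in powM a n.
  apply: rpred_sum => -[i /=]; rewrite ltnS => hi _ /=.
  exact: (powMZ_sub hi (gr_rep_pow (u _)) (gr_rep_pow (v _))).
have cE (P : lmodType A) (u : gr A^o) (v : gr P) n :
  gr_scale u v n =
  gr_class a n (\sum_(i < n.+1) (gr_rep (u i) : A) *: gr_rep (v (n - i)%N)).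
  exact: (gr_scaleE n (gP _ u) (gK _ u) (gP _ v) (gK _ v)).
apply: direct_sumP => n.
rewrite (gr_scaleE n (gP _ x) (gK _ x) (cP _ y z) (cE _ y z)).
rewrite (gr_scaleE n (cP _ x y) (cE _ x y) (gP _ z) (gK _ z)).
congr gr_class; pose F i j k := (gr_rep (x i) : A) *:
  ((gr_rep (y j) : A) *: gr_rep (z k)).
transitivity (\sum_(j < n.+1) \sum_(k < (n - j).+1) F j k (n - j - k)%N).
  by apply: eq_bigr => i _; rewrite scaler_sumr.
rewrite -sum_triangle; apply: eq_bigr => i _; rewrite scaler_suml.
by apply: eq_bigr => j _; rewrite /F scalerA.
Qed.

Lemma gr_mulC (x y : gr A^o) : gr_scale x y = gr_scale y x.
Proof.
apply: direct_sumP => n.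
rewrite /= /gr_scale_comp (reindex_inj rev_ord_inj) /=.
apply: eq_bigr => -[i /=]; rewrite ltnS => hi _ /=.
by rewrite subSS subKn // /GRing.scale /= mulrC.
Qed.

Definition gr_ring : Type := gr A^o.
HB.instance Definition _ := GRing.Zmodule.on gr_ring.
HB.instance Definition _ := GRing.Zmodule_isComPzRing.Build gr_ring
  (@gr_scaleA A^o) gr_mulC (@gr_scale1 A^o) (@gr_scaleDl A^o).

HB.instance Definition _ (M : lmodType A) :=
  GRing.Zmodule_isLmodule.Build gr_ring (gr M)
    (@gr_scaleA M) (@gr_scale1 M) (@gr_scaleD M)
    (fun y x x' => gr_scaleDl x x' y).

End Graded.

Section StarHom.
Variables (R : comPzRingType) (E F : lmodType R).
Variables (gE : int -> {pred E}) (gF : int -> {pred F}).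

Definition homogeneous_map (d : int) (f : E -> F) : Prop :=
  linear f /\ forall i x, x \in gE i -> f x \in gF (i + d).

(* The sum of the homogeneous parts inside Hom_R(E, F); it is direct as soon
   as E is the sum of the gE i and the sum of the gF i is direct. *)
Definition star_hom : {pred (E -> F)} :=
  [pred f : E -> F | `[< exists s : seq (int * (E -> F)),
      (forall p, p \in s -> homogeneous_map p.1 p.2) /\
      f = \sum_(p <- s) p.2 >]].

Lemma star_homP f : reflect (exists s : seq (int * (E -> F)),
      (forall p, p \in s -> homogeneous_map p.1 p.2) /\
      f = \sum_(p <- s) p.2) (f \in star_hom).
Proof. exact: asboolP. Qed.

End StarHom.

Section GrStarHom.
Variables (A : comNzRingType) (a : {pred A}).

Lemma gr_homogP (M : lmodType A) (x : gr a M) d :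
  reflect (forall n, x n != 0 -> n%:Z = d) (x \in gr_homog d).
Proof. exact: asboolP. Qed.

Lemma gr_homogZ (M : lmodType A) (r : gr_ring a) (x : gr a M) i j :
  (r : gr a A^o) \in gr_homog i -> x \in gr_homog j ->
  r *: x \in gr_homog (i + j).
Proof.
move=> /gr_homogP ri /gr_homogP xj; apply/gr_homogP => n.
apply: contraNeq => nij; apply/eqP; apply: big1 => -[k /=].
rewrite ltnS => hk _; apply: gr_class0.
have [rk|/ri ek] := eqVneq ((r : gr a A^o) k) 0.
  apply: (@powMZ_eq _ _ _ k.+1 (n - k)); first by rewrite addSn subnKC.
    by rewrite rk; exact: gr_rep0.
  exact: gr_rep_pow.
have [xk|/xj el] := eqVneq (x (n - k)%N) 0.
  apply: (@powMZ_eq _ _ _ k (n - k).+1); first by rewrite addnS subnKC.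
    exact: gr_rep_pow.
  by rewrite xk; exact: gr_rep0.
by rewrite -ek -el -PoszD subnKC // eqxx in nij.
Qed.

Lemma gr_comp_fin (M : lmodType A) (x : gr a M) i :
  exists N, forall n, (N <= n)%N -> (if n == i then x n else 0) = 0.
Proof. by have [N hx] := dcomp_fin x; exists N => n /hx ->; case: ifP. Qed.

Definition gr_comp (M : lmodType A) (x : gr a M) i : gr a M :=
  DirectSum (gr_comp_fin x i).

Lemma gr_comp_homog (M : lmodType A) (x : gr a M) (i : nat) :
  gr_comp x i \in gr_homog i.
Proof.
by apply/gr_homogP => n /=; have [->//|_] := eqVneq n i; rewrite eqxx.
Qed.

Lemma gr_decomp (M : lmodType A) (x : gr a M) :
  exists N, x = \sum_(i <- iota 0 N) gr_comp x i.
Proof.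
have [N hx] := dcomp_fin x; exists N; apply: direct_sumP => n.
have dsum (s : seq nat) (G : nat -> gr a M) :
    (\sum_(i <- s) G i) n = \sum_(i <- s) G i n.
  by elim: s => [|i s IH]; rewrite ?big_nil // !big_cons dcompD IH.
rewrite dsum /=; have [nN|Nn] := ltnP n N.
  rewrite (bigD1_seq n) ?iota_uniq ?mem_iota //= eqxx big1 ?addr0 //.
  by move=> i /negPf; rewrite eq_sym => ->.
by rewrite hx // big1 // => i _; case: ifP.
Qed.

Variables M N : lmodType A.

Definition gr_star_hom : {pred (gr a M -> gr a N)} :=
  star_hom (@gr_homog A a M) (@gr_homog A a N).

Lemma gr_star_hom_submod : submod_closed gr_star_hom.
Proof.
split; first by apply/star_homP; exists [::]; rewrite big_nil.
move=> c f g /star_homP[s [hs ->]] /star_homP[t [ht ->]].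
have [k hk] := gr_decomp (c : gr a A^o).
apply/star_homP.
exists ([seq (p.1 + i%:Z, (gr_comp (c : gr a A^o) i : gr_ring a) *: p.2)
          | p <- s, i <- iota 0 k] ++ t); split.
  move=> p; rewrite mem_cat => /orP[/allpairsP[[q i] /= [qs _ ->]]|/ht//].
  have [ql qh] := hs _ qs; split=> /=.
    have fE (r : gr_ring a) (h : gr a M -> gr a N) w : (r *: h) w = r *: h w.
      by [].
    by move=> b u v; rewrite !fE ql scalerDr !scalerA mulrC.
  move=> d x hx; rewrite addrA addrC; apply: gr_homogZ.
    exact: gr_comp_homog.
  exact: qh.
rewrite big_cat big_allpairs_dep; congr (_ + _).
rewrite scaler_sumr; apply: eq_bigr => p _ /=.
by rewrite -scaler_suml -hk.
Qed.

HB.instance Definition _ :=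
  GRing.isSubmodClosed.Build (gr_ring a) (gr a M -> gr a N)
    gr_star_hom gr_star_hom_submod.

(* *Hom_(G_a(A)) (G_a(M), G_a(N)) *)
Definition starHom : Type := {f : gr a M -> gr a N | f \in gr_star_hom}.
HB.instance Definition _ := SubChoice.on starHom.
HB.instance Definition _ := [SubChoice_isSubLmodule of starHom by <:].

End GrStarHom.

(* Main.v *)
From HB Require Import structures.
Require Import Defs.
From mathcomp Require Import all_boot all_order all_algebra.
From mathcomp Require Import ring_quotient constructive_ereal.
From mathcomp Require Import boolp zify.

(* Filter H = Hom_A(M, A) by F_d = {f | f(a^n M) <= a^(n+d) for all n}. The
   associated graded module embeds into *Hom(G(M), G(A)), and passing to initial
   forms turns strict chains of submodules of H into strict chains of graded
   submodules. For a composition series N_0 < ... < N_L of M, the initial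
   submodules of the N_i form a composition series of G(M), so G(M) has length
   at most L. Since A is self-injective with nonzero socle, it cogenerates the
   finitely generated modules, so the annihilators of the N_i in H form a strict
   chain of length L, whose initial submodules bound the length of *Hom below.
   Self-injectivity follows from finite injective dimension by descending along
   the resolution: with s in the socle of A, a socle element of an injective
   kernel is s w for some w, hence lifts to a socle element one step earlier. *)

Set Implicit Arguments.
Unset Strict Implicit.
Unset Printing Implicit Defensive.

Import Order.TTheory GRing.Theory Num.Theory.

Local Open Scope ring_scope.

(** * Submodules as predicates, and adjoining one generator *)

Lemma eq_pred (T : Type) (P Q : {pred T}) : P =i Q -> P = Q.
Proof. by move=> PQ; apply: funext => x; apply: PQ. Qed.

Lemma subset_anti (T : Type) (P Q : {pred T}) :
  {subset P <= Q} -> {subset Q <= P} -> P =i Q.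
Proof. by move=> PQ QP x; apply/idP/idP; [apply: PQ|apply: QP]. Qed.

Section Closed.
Variables (R : pzRingType) (V : lmodType R).
Variables (N : {pred V}) (hN : submod_closed N).

Lemma submod0 : 0 \in N. Proof. by case: hN. Qed.
Lemma submodD x y : x \in N -> y \in N -> x + y \in N.
Proof. by move=> hx hy; rewrite -[x]scale1r; case: hN => _ h; apply: h. Qed.
Lemma submodZ c x : x \in N -> c *: x \in N.
Proof. by move=> hx; rewrite -[c *: x]addr0; case: hN => ? h; apply: h. Qed.
Lemma submodN x : x \in N -> - x \in N.
Proof. by move=> hx; rewrite -scaleN1r submodZ. Qed.
Lemma submodB x y : x \in N -> y \in N -> x - y \in N.
Proof. by move=> hx hy; rewrite submodD ?submodN. Qed.
Lemma submodDl x y : x \in N -> (x + y \in N) = (y \in N).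
Proof.
move=> hx; apply/idP/idP => [h|]; last exact: submodD.
by rewrite -(addKr x y) addrC submodB.
Qed.
Lemma submod_sum I (s : seq I) (P : pred I) (F : I -> V) :
  (forall i, P i -> F i \in N) -> \sum_(i <- s | P i) F i \in N.
Proof. by move=> h; apply: (big_ind (fun x => x \in N)); [exact: submod0|exact: submodD|]. Qed.

End Closed.

Lemma predT_submod (R : pzRingType) (V : lmodType R) :
  submod_closed (predT : {pred V}).
Proof. by split. Qed.

Lemma pred1_submod (R : pzRingType) (V : lmodType R) :
  submod_closed (pred1 (0 : V)).
Proof.
split=> [|c x y]; rewrite !inE // => /eqP-> /eqP->.
by rewrite scaler0 addr0.
Qed.

Section AddGen.
Variables (R : pzRingType) (V : lmodType R).
Implicit Types (N : {pred V}) (y : V).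

(** The submodule N + R y, in a form where membership hands over the coefficient of y. *)
Definition addgen N y : {pred V} := [pred z | `[< exists c, z - c *: y \in N >]].

Lemma addgenP N y z : reflect (exists c, z - c *: y \in N) (z \in addgen N y).
Proof. exact: asboolP. Qed.

Lemma addgen_submod N y : submod_closed N -> submod_closed (addgen N y).
Proof.
move=> hN; split; first by apply/addgenP; exists 0; rewrite scale0r subr0 submod0.
move=> c u v /addgenP[b hb] /addgenP[d hd]; apply/addgenP; exists (c * b + d).
rewrite scalerDl -scalerA opprD addrACA -scalerBr.
by case: hN => _ h; apply: h.
Qed.

Lemma sub_addgen N y : {subset N <= addgen N y}.
Proof. by move=> x hx; apply/addgenP; exists 0; rewrite scale0r subr0. Qed.

Lemma addgen_gen N y : submod_closed N -> y \in addgen N y.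
Proof. by move=> hN; apply/addgenP; exists 1; rewrite scale1r subrr submod0. Qed.

Lemma addgen_id N y : submod_closed N -> y \in N -> addgen N y = N.
Proof.
move=> hN hy; apply/eq_pred/subset_anti; last exact: sub_addgen.
move=> z /addgenP[c hc]; rewrite -(subrK (c *: y) z).
by apply: submodD => //; apply: submodZ.
Qed.

End AddGen.

(** * Chain conditions and comparison of chains with a composition series *)

Section Chains.
Variables (R : pzRingType) (V : lmodType R).

Lemma infinite_chain (T : Type) (x0 : T) (r : T -> T -> Prop) :
  (forall x, exists y, r x y) -> exists f : nat -> T, forall n, r (f n) (f n.+1).
Proof. by move=> /choice[g hg]; exists (fun n => iter n g x0) => n /=. Qed.

Lemma noetherian_max (P : {pred V} -> Prop) N0 : noetherian_module V ->
  (forall N, P N -> submod_closed N) -> P N0 ->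
  exists N, P N /\ forall N', P N' -> {subset N <= N'} -> N' =i N.
Proof.
move=> acc PV P0; apply: contrapT => hn.
have step (x : {N | P N}) :
    exists y : {N | P N}, {subset sval x <= sval y} /\ ~ (sval y =i sval x).
  apply: contrapT => hx; apply: hn; exists (sval x); split; first exact: svalP.
  move=> N' PN' sub; apply: contrapT => ne.
  by apply: hx; exists (exist _ N' PN').
have [f hf] := infinite_chain (exist _ N0 P0) step.
have [n hn'] := acc (fun i => sval (f i)) (fun i => PV _ (svalP (f i)))
  (fun i => (hf i).1).
by apply: (hf n).2; apply: hn'.
Qed.

Lemma artinian_min (P : {pred V} -> Prop) N0 : artinian_module V ->
  (forall N, P N -> submod_closed N) -> P N0 ->
  exists N, P N /\ forall N', P N' -> {subset N' <= N} -> N' =i N.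
Proof.
move=> dcc PV P0; apply: contrapT => hn.
have step (x : {N | P N}) :
    exists y : {N | P N}, {subset sval y <= sval x} /\ ~ (sval y =i sval x).
  apply: contrapT => hx; apply: hn; exists (sval x); split; first exact: svalP.
  move=> N' PN' sub; apply: contrapT => ne.
  by apply: hx; exists (exist _ N' PN').
have [f hf] := infinite_chain (exist _ N0 P0) step.
have [n hn'] := dcc (fun i => sval (f i)) (fun i => PV _ (svalP (f i)))
  (fun i => (hf i).1).
by apply: (hf n).2; apply: hn'.
Qed.

(* For submodules [K] inside [K'], equality of the numbers of indices [i] at
   which [K], resp. [K'], meets [C i.+1] outside [C i] forces [K = K']. *)
Lemma chain_le_composition_series n (C : nat -> {pred V}) k
    (K : nat -> {pred V}) :
  composition_series n C ->
  (forall i, (i <= k)%N -> submod_closed (K i)) ->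
  (forall i, (i < k)%N -> {subset K i <= K i.+1} /\ ~ (K i.+1 =i K i)) ->
  (k <= n)%N.
Proof.
move=> [hC C0 Cn hS] hK hs.
pose jump i j : bool := `[< exists x, [/\ x \in K i, x \in C j.+1 & x \notin C j] >].
pose d i := (\sum_(j < n) jump i j)%N.
have jumpS i j : (i < k)%N -> jump i j -> jump i.+1 j.
  move=> /hs[sub _] /asboolP[x [x1 x2 x3]]; apply/asboolP; exists x.
  by split=> //; apply: sub.
have lt_d i : (i < k)%N -> (d i < d i.+1)%N.
  move=> ik; have [sub ne] := hs i ik.
  have le j : (jump i j <= jump i.+1 j)%N.
    by case E : (jump i j) => //; rewrite jumpS.
  rewrite ltn_neqAle leq_sum ?andbT //; apply/negP => /eqP e.
  apply: ne; apply: subset_anti => // x hx.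
  have eqj (j : 'I_n) : jump i j = jump i.+1 j.
    apply/idP/idP => [|h1]; first exact: jumpS.
    apply: contraT => h0; suff lt : (d i < d i.+1)%N by rewrite e ltnn in lt.
    rewrite /d (bigD1 j) //= [X in (_ < X)%N](bigD1 j) //= (negPf h0) h1.
    by rewrite add0n add1n ltnS leq_sum.
  (* With equal jumps, K i.+1 is absorbed into K i one layer of the composition series at a time. *)
  suff H j : (j <= n)%N -> {subset [pred z | z \in K i.+1 & z \in C j] <= K i}.
    by apply: (H n) => //; rewrite inE hx Cn.
  elim: j => [_ z|j IH jn z]; rewrite inE => /andP[zK].
    rewrite C0 inE => /eqP->; exact: (submod0 (hK i (ltnW ik))).
  move=> zC; have [zCj|zCj] := boolP (z \in C j).
    by apply: IH; rewrite ?inE ?zK // ltnW.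
  have : jump i.+1 j by apply/asboolP; exists z.
  rewrite -(eqj (Ordinal jn)) => /asboolP[w [wK wC wCj]].
  have [subC _ maxC] := hS j jn.
  (* S is (K i ∩ C j.+1) + C j. The element w keeps it from being C j, so by simplicity of the layer
     it is C j.+1, and z agrees modulo C j with an element v of K i. *)
  pose S : {pred V} := [pred u | `[< exists v, [/\ v \in K i, v \in C j.+1 & u - v \in C j] >]].
  have hSub : submod_closed S.
    split.
      apply/asboolP; exists 0; rewrite subr0.
      by split; [exact: submod0 (hK i (ltnW ik))|exact: submod0|exact: submod0].
    move=> c u v /asboolP[u' [u1 u2 u3]] /asboolP[v' [v1 v2 v3]].
    apply/asboolP; exists (c *: u' + v'); split.
    - by case: (hK i (ltnW ik)) => _ h; apply: h.
    - by case: (hC j.+1) => _ h; apply: h.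
    - by rewrite opprD addrACA -scalerBr; case: (hC j) => _ h; apply: h.
  have [] := maxC S hSub.
  - move=> u uC; apply/asboolP; exists 0; rewrite subr0; split=> //.
      exact: submod0 (hK i (ltnW ik)).
    exact: submod0.
  - move=> u /asboolP[v [_ v2 v3]]; rewrite -(subrK v u).
    by apply: submodD => //; apply: subC.
  - move=> /(_ w); rewrite (negPf wCj) => /negP[].
    by apply/asboolP; exists w; rewrite subrr submod0.
  move=> /(_ z); rewrite zC => /asboolP[v [v1 v2 v3]].
  rewrite -(subrK v z); apply: submodD => //; first exact: hK (ltnW ik).
  apply: IH; first exact: ltnW.
  rewrite inE v3 andbT; apply: submodB => //; first exact: hK.
  exact: sub.
have ge i : (i <= k)%N -> (i <= d i)%N.
  by elim: i => // i IH ik; apply: leq_ltn_trans (lt_d i ik); apply/IH/ltnW.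
apply: leq_trans (ge k (leqnn k)) _.
rewrite -[X in (_ <= X)%N](card_ord n) -sum1_card; apply: leq_sum => j _.
exact: leq_b1.
Qed.

End Chains.

(** * Units in a noetherian local ring *)

Section Local.
Variables (A : comNzRingType) (m : {pred A}).
Hypotheses (hm : local_ring m) (hN : noetherian_ring A).

Lemma ideal_submod (J : {pred A}) : idealr_closed J ->
  submod_closed (J : {pred A^o}).
Proof. by case=> J0 _ hJ; split=> // c x y; apply: hJ. Qed.

Let mV : submod_closed (m : {pred A^o}). Proof. exact: ideal_submod hm.1.1. Qed.

(** A non-unit generates a proper ideal; the noetherian condition places it in a maximal ideal,
    which can only be m. *)
Lemma local_unit x : x \notin m -> exists y, x * y = 1.
Proof.
move=> xm; apply: contrapT => nx.
pose J : {pred A} := [pred z | `[< exists y, z = x * y >]].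
have xJ : x \in J by apply/asboolP; exists 1; rewrite mulr1.
have idJ : idealr_closed J.
  split; first by apply/asboolP; exists 0; rewrite mulr0.
    by apply/asboolP => -[y e]; apply: nx; exists y.
  move=> c u v /asboolP[u' ->] /asboolP[v' ->]; apply/asboolP.
  by exists (c * u' + v'); rewrite mulrDr mulrCA.
pose P (N : {pred A^o}) := idealr_closed (N : {pred A}) /\ {subset J <= N}.
have [N [[idN JN] maxN]] := @noetherian_max A A^o P J hN
  (fun N PN => ideal_submod PN.1) (conj idJ (fun _ => id)).
suff maxi : maximal_ideal (N : {pred A}) by rewrite -(hm.2 _ maxi) JN in xm.
split=> // I idI sub; apply: (maxN I) => //; split=> // z /JN; exact: sub.
Qed.

Lemma proper_sub_max (a : {pred A}) : idealr_closed a -> {subset a <= m}.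
Proof.
move=> ha x xa; apply: contraT => /local_unit[y xy].
case: ha => a0 /negP a1 h; case: a1; rewrite -xy -[x * y]addr0 mulrC; exact: h.
Qed.

(** * Socle elements and chains with quotients A/m *)

Section Module.
Variable V : lmodType A.
Implicit Type N : {pred V}.

Definition kills N y := forall r, r \in m -> r *: y \in N.

(** Any r outside m is a unit, so r y in N would give y in N. Hence N + A y over N is a copy of
    A/m. *)
Lemma colon_max N y r : submod_closed N -> kills N y -> y \notin N ->
  (r *: y \in N) = (r \in m).
Proof.
move=> hV ky yN; apply/idP/idP; last exact: ky.
apply: contraTT => /local_unit[s rs]; apply: contra yN => h.
by rewrite -[y]scale1r -rs mulrC -scalerA submodZ.
Qed.

Hypothesis artA : artinian_ring A.

(** Among the principal ideals r A with r x outside N a minimal one is taken; its r x is the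
    required socle element modulo N. *)
Lemma exists_socle N x : submod_closed N -> x \notin N ->
  exists2 y, y \notin N & kills N y.
Proof.
move=> hV xN.
pose mul r : {pred A^o} := [pred z | `[< exists t, z = t * r >]].
have := @artinian_min A A^o
  (fun I => exists2 r, r *: x \notin N & I = mul r) (mul 1) artA.
case=> [||_ [[r rx ->] minr]].
- move=> _ [r _ ->]; split; first by apply/asboolP; exists 0; rewrite mul0r.
  move=> c u v /asboolP[u' ->] /asboolP[v' ->]; apply/asboolP.
  by exists (c * u' + v'); rewrite mulrDl -mulrA.
- by exists 1; rewrite ?scale1r.
exists (r *: x) => // t tm; apply: contraT.
rewrite scalerA => trN.
have sub : {subset mul (t * r) <= mul r}.
  by move=> _ /asboolP[s ->]; apply/asboolP; exists (s * t); rewrite mulrA.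
(* Minimality gives r = s t r with s t in m. The unit 1 - s t then kills r, so r = 0 and r x lies in
   N. *)
have /(_ r) := minr _ (ex_intro2 _ _ (t * r) trN erefl) sub.
have -> : r \in mul r by apply/asboolP; exists 1; rewrite mul1r.
move=> /asboolP[s e].
have : 1 - s * t \notin m.
  have nm1 : 1 \notin m by case: hm.1.1.
  apply: contra nm1 => h; rewrite -(subrK (s * t) 1); apply: (submodD mV h).
  exact: (submodZ mV s tm).
move=> /local_unit[u hu]; case/negP: rx.
have -> : r = 0.
  rewrite -[r]mul1r -hu mulrAC mulrBl mul1r -mulrA -e subrr mul0r //.
by rewrite scale0r submod0.
Qed.

(* Submodules joined to 0 by a chain whose successive quotients are 0 or A/m. *)
Inductive reach : {pred V} -> Prop :=
| reach0 : reach (pred1 0)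
| reachS N y : reach N -> kills N y -> reach (addgen N y).

Lemma reach_submod N : reach N -> submod_closed N.
Proof.
by elim=> [|N' y _ IH _]; [exact: pred1_submod|exact: addgen_submod].
Qed.

(** A maximal [reach] submodule is everything: a proper one could be enlarged by a socle element of
    the quotient. *)
Lemma reach_noetherian : noetherian_module V -> reach (predT : {pred V}).
Proof.
move=> acc; have [N [rN maxN]] := noetherian_max acc reach_submod reach0.
suff -> : (predT : {pred V}) = N by [].
apply/eq_pred/subset_anti => // x _; apply: contraT => xN.
have [y yN ky] := exists_socle (reach_submod rN) xN.
have := maxN _ (reachS rN ky) (@sub_addgen _ _ N y) y.
by rewrite (negPf yN) addgen_gen //; apply: reach_submod.
Qed.


(** Generators already present are dropped, so every remaining quotient is exactly A/m. *)
Lemma reach_flag N : reach N -> exists L (F : nat -> {pred V}),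
  [/\ forall i, submod_closed (F i), F 0%N = pred1 0, F L = N &
    forall i, (i < L)%N ->
      exists y, [/\ y \notin F i, kills (F i) y & F i.+1 = addgen (F i) y]].
Proof.
elim=> [|N' y rN [L [F [hF F0 FL FS]]] ky].
  exists 0%N, (fun=> pred1 0 : {pred V}); split=> // _; exact: pred1_submod.
have NV := reach_submod rN.
have [yN|yN] := boolP (y \in N').
  by rewrite addgen_id //; exists L, F.
exists L.+1, (fun i => if (i <= L)%N then F i else addgen N' y); split.
- by move=> i; case: ifP => // _; apply: addgen_submod.
- by [].
- by rewrite ltnn.
move=> i; rewrite ltnS leq_eqVlt => /predU1P[->|iL].
  by exists y; rewrite eqxx ltnn FL.
by have [z hz] := FS i iL; exists z; rewrite iL orbT.
Qed.

End Module.

(** The chain from 0 to A is carried by c ↦ c e to a chain from N to N + A e: a step by y in A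
    becomes a step by y e. *)
Lemma reach_addgen_cyclic (V : lmodType A) (N : {pred V}) e :
  reach (predT : {pred A^o}) -> reach N -> reach (addgen N e).
Proof.
move=> rA rN; pose S (C : {pred A^o}) : {pred V} :=
  [pred z | `[< exists2 c : A, c \in C & z - c *: e \in N >]].
suff H (C : {pred A^o}) : reach C -> reach (S C).
  have -> : addgen N e = S predT; last exact: H.
  apply/eq_pred/subset_anti => z.
    by move=> /addgenP[c hc]; apply/asboolP; exists c.
  by move=> /asboolP[c _ hc]; apply/addgenP; exists c.
elim=> [|C' y rC rS ky].
  suff -> : S (pred1 0) = N by [].
  apply/eq_pred/subset_anti => z.
    by move=> /asboolP[c]; rewrite inE => /eqP->; rewrite scale0r subr0.
  by move=> zN; apply/asboolP; exists 0; rewrite ?inE // scale0r subr0.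
have -> : S (addgen C' y) = addgen (S C') ((y : A) *: e).
  apply/eq_pred/subset_anti => z.
    move=> /asboolP[c /addgenP[r hr] hc]; apply/addgenP; exists r.
    apply/asboolP; exists (c - r *: y) => //.
    by rewrite scalerA -addrA -opprD -scalerDl [X in X *: e]addrC subrK.
  move=> /addgenP[r /asboolP[c cC hc]]; apply/asboolP; exists (c + r *: y).
    by apply/addgenP; exists r; rewrite addrK.
  by rewrite scalerDl opprD addrA addrAC -scalerA.
apply: reachS => // r rm; apply/asboolP; exists (r * y); first exact: ky.
by rewrite scalerA subrr submod0 //; apply: reach_submod.
Qed.

Lemma reach_fin_gen (V : lmodType A) :
  reach (predT : {pred A^o}) -> fin_gen_module V -> reach (predT : {pred V}).
Proof.
move=> rA [n [e he]].
pose span (s : seq 'I_n) := foldr (fun i N => addgen N (e i)) (pred1 0) s.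
suff -> : (predT : {pred V}) = span (enum 'I_n).
  by elim: (enum 'I_n) => [|i s IH] /=; [apply: reach0|apply: reach_addgen_cyclic].
apply/eq_pred/subset_anti => // x _; have [c ->] := he x.
rewrite -big_enum /=; elim: (enum 'I_n) => [|i s IH]; first by rewrite big_nil inE.
by rewrite big_cons; apply/addgenP; exists (c i); rewrite addrAC subrr add0r.
Qed.

(** Since a lies in m, each multiplication by a pushes a member of the chain into the previous
    one. *)
Lemma powM_eq0 (a : {pred A}) (V : lmodType A) : {subset a <= m} ->
  reach (predT : {pred V}) -> exists r, forall x : V, x \in powM a r -> x = 0.
Proof.
move=> am.
suff H (N : {pred V}) : reach N -> exists r,
    {subset iter r (@ideal_mul A a _) N <= pred1 0}.
  move=> /H[r hr]; exists r => x xr; apply/eqP/(hr x).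
  suff -> : iter r (@ideal_mul A a _) (predT : {pred V}) = powM a r by [].
  by elim: (r) => //= k ->.
have mono (P Q : {pred V}) r : {subset P <= Q} ->
    {subset iter r (@ideal_mul A a _) P <= iter r (@ideal_mul A a _) Q}.
  move=> sub; elim: r => //= r IH x /ideal_mulP[s [hs ->]].
  by apply/ideal_mulP; exists s; split=> // p /hs/andP[-> /IH].
elim=> [|N' y rN [r hr] ky]; first by exists 0%N.
exists r.+1 => x; rewrite iterSr => hx; apply: hr; move: x hx; apply: mono => x.
have NV := reach_submod rN.
move=> /ideal_mulP[s [hs ->]]; rewrite big_seq; apply: submod_sum => // p.
move=> /hs/andP[/am pm /addgenP[c hc]].
rewrite -(subrK (c *: y) p.2) scalerDr; apply: submodD => //.
  exact: submodZ.
by rewrite scalerA mulrC -scalerA; apply/(submodZ NV)/ky.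
Qed.

(** * Extension of linear maps and self-injectivity *)

Section Extension.

(** A map on a submodule is encoded as a total function whose values outside N are arbitrary. *)
Definition linear_on (V E : lmodType A) (N : {pred V}) (f : V -> E) :=
  forall c, {in N &, forall u v, f (c *: u + v) = c *: f u + f v}.

Lemma linear_on0 (V E : lmodType A) (N : {pred V}) (f : V -> E) :
  submod_closed N -> linear_on N f -> f 0 = 0.
Proof.
move=> NV lf; have N0 := submod0 NV.
by have := lf (-1) 0 0 N0 N0; rewrite !scaleN1r !addNr.
Qed.

(** The only relations between y and N are r y in N with r in m; a value b compatible with them
    extends f by u + r y ↦ f u + r b. *)
Lemma extend_step (V E : lmodType A) (N : {pred V}) (f : V -> E) y b :
  submod_closed N -> linear_on N f -> y \notin N -> kills N y ->
  {in m, forall r, f (r *: y) = r *: b} ->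
  exists g, [/\ linear_on (addgen N y) g, {in N, g =1 f} & g y = b].
Proof.
move=> NV lf yN ky fb.
have /choice[ch hch] z : exists c, z \in addgen N y -> z - c *: y \in N.
  have [/addgenP[c hc]|_] := boolP (z \in addgen N y).
    by exists c.
  by exists 0.
pose g z := f (z - ch z *: y) + ch z *: b.
(* Two coefficients of y for the same element differ by an element of m, where f and b agree, so the
   choice [ch] does not matter. *)
have gE u r : u \in N -> g (u + r *: y) = f u + r *: b.
  move=> uN; have : u + r *: y \in addgen N y.
    by apply/addgenP; exists r; rewrite addrK.
  move=> /hch; rewrite /g; set r' := ch _.
  rewrite -addrA -scalerBl submodDl // (colon_max _ NV ky yN) => rm.
  rewrite -[u]scale1r lf ?ky // !scale1r fb // -addrA; congr (_ + _).
  by rewrite -scalerDl subrK.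
exists g; split.
- move=> c z z' /addgenP[r hr] /addgenP[r' hr'].
  have -> : c *: z + z' = (c *: (z - r *: y) + (z' - r' *: y)) + (c * r + r') *: y.
    by rewrite scalerBr scalerDl scalerA addrACA !subrK.
  rewrite gE; last by apply: submodD => //; apply: submodZ.
  rewrite lf // -[in RHS](subrK (r *: y) z) -[in RHS](subrK (r' *: y) z') !gE //.
  by rewrite scalerDl scalerDr scalerA addrACA.
- by move=> u uN; have := gE u 0 uN; rewrite !scale0r !addr0.
- have := gE 0 1 (submod0 NV); rewrite !scale1r add0r => ->.
  by rewrite (linear_on0 NV lf) add0r.
Qed.

(* Ext^1(A/m, Z) = 0 for the submodule [Z] of [E]. *)
Definition ext_max (E : lmodType A) (Z : {pred E}) :=
  forall h : A^o -> E, linear_on (m : {pred A^o}) h -> {in m, forall r, h r \in Z} ->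
  exists2 z, z \in Z & {in m, forall r : A, h r = r *: z}.

(** The chain of V is added to N generator by generator, and [ext_max] supplies the value at each
    new one. Keeping the values in Z lets a mere submodule of E serve as target. *)
Lemma extend_linear (V E : lmodType A) (N : {pred V}) (Z : {pred E}) f :
  reach (predT : {pred V}) -> submod_closed N -> submod_closed Z ->
  ext_max Z -> linear_on N f -> {in N, forall x, f x \in Z} ->
  exists g : V -> E, [/\ linear g, {in N, g =1 f} & forall x, g x \in Z].
Proof.
move=> rV NV ZV extZ lf fZ.
pose S (C : {pred V}) : {pred V} :=
  [pred z | `[< exists2 c, c \in C & z - c \in N >]].
have S0 : S (pred1 0) = N.
  apply/eq_pred/subset_anti => z.
    by move=> /asboolP[c]; rewrite inE => /eqP->; rewrite subr0.
  by move=> zN; apply/asboolP; exists 0; rewrite ?inE // subr0.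
have SD C y : S (addgen C y) = addgen (S C) y.
  apply/eq_pred/subset_anti => z.
    move=> /asboolP[c /addgenP[r hr] hc]; apply/addgenP; exists r.
    apply/asboolP; exists (c - r *: y) => //.
    by rewrite opprB addrA subrK.
  move=> /addgenP[r /asboolP[c cC hc]]; apply/asboolP; exists (c + r *: y).
    by apply/addgenP; exists r; rewrite addrK.
  by rewrite opprD addrA addrAC.
have SV C : reach C -> submod_closed (S C).
  elim=> [|C' y _ IH _]; first by rewrite S0.
  by rewrite SD; apply: addgen_submod.
have NS C : reach C -> {subset N <= S C}.
  by move=> /reach_submod CV x xN; apply/asboolP; exists 0; rewrite ?subr0 ?submod0.
suff H (C : {pred V}) : reach C -> exists g : V -> E,
    [/\ linear_on (S C) g, {in N, g =1 f} & {in S C, forall x, g x \in Z}].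
  have ST x : x \in S predT by apply/asboolP; exists x; rewrite ?subrr ?submod0.
  have [g [lg gf gZ]] := H _ rV; exists g; split=> // [c u v|x]; last exact: gZ.
  exact: lg.
elim=> [|C' y rC [g [lg gf gZ]] ky]; first by rewrite S0; exists f.
rewrite SD; have [yS|yS] := boolP (y \in S C').
  by rewrite addgen_id //; [exists g|apply: SV].
have kS : kills (S C') y.
  move=> r rm; apply/asboolP; exists (r *: y); rewrite ?subrr ?submod0 //.
  exact: ky.
have lh : linear_on (m : {pred A^o}) (fun r : A^o => g ((r : A) *: y)).
  by move=> c u v um vm /=; rewrite scalerDl -scalerA lg // kS.
have [b bZ hb] := extZ _ lh (fun r rm => gZ _ (kS r rm)).
have [g' [lg' g'g g'y]] := extend_step (SV _ rC) lg yS kS hb.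
exists g'; split=> //.
  by move=> x xN; rewrite g'g ?gf //; apply: NS.
move=> x /addgenP[r hr]; rewrite -(subrK (r *: y) x) addrC.
have ySy : y \in addgen (S C') y by apply: addgen_gen; apply: SV.
rewrite lg' ?g'y ?g'g //; last exact: sub_addgen.
by apply: submodD; rewrite ?submodZ ?gZ.
Qed.

Lemma injective_ext_max (E : lmodType A) :
  injective_module E -> ext_max (predT : {pred E}).
Proof.
move=> injE h lh _.
(* The ideal m is written as the first power m A, for which [pow_sub] provides a module
   structure. *)
have m1 x : (x \in @powM A m A^o 1) = (x \in m).
  apply/ideal_mulP/idP => [[s [hs ->]]|xm].
    rewrite big_seq; apply: (submod_sum mV) => p /hs/andP[pm _].
    by rewrite /GRing.scale /= mulrC; apply: (submodZ mV).
  exists [:: (x, 1)]; split=> [p|]; first by rewrite inE => /eqP->; rewrite xm.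
  by rewrite big_seq1 /GRing.scale /= mulr1.
pose W := pow_sub m A^o 1.
have Wm (w : W) : (val w : A) \in m by rewrite -m1; apply: valP.
have lhv : linear (fun w : W => h (val w)).
  by move=> c u v; rewrite linearP; exact: lh (Wm u) (Wm v).
pose F : {linear W -> E} := HB.pack (fun w : W => h (val w))
  (GRing.isLinear.Build _ _ _ _ (fun w : W => h (val w)) lhv).
pose I : {linear W -> A^o} := HB.pack (fun w : W => val w : A^o)
  (GRing.isLinear.Build _ _ _ _ (fun w : W => val w : A^o)
    (fun c u v => linearP (val : W -> A^o) c u v)).
have [g hg] := injE W A^o I F val_inj.
exists (g 1) => // r rm.
have rm1 : (r : A^o) \in @powM A m A^o 1 by rewrite m1.
pose w : W := Sub (r : A^o) rm1; have wE : val w = r by apply: SubK.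
have : g (val w) = h (val w) := hg w; rewrite wE => <-.
by rewrite -linearZ /= /GRing.scale /= mulr1.
Qed.

Variable s : A.
Hypotheses (s0 : s != 0) (ks : {in m, forall r, r * s = 0}).
Hypothesis rA : reach (predT : {pred A^o}).

(** The map h is multiplication by some e of E, and e must be moved into the kernel of d. If d e = s
    (d e'), then e - s e' works, because m s = 0 leaves the multiples by m unchanged. *)
Lemma ext_max_ker (E E' : lmodType A) (d : {linear E -> E'}) (Z : {pred E'}) :
  injective_module E -> submod_closed Z -> ext_max Z ->
  (forall x, d x \in Z) -> {in Z, forall z, exists x, d x = z} ->
  ext_max [pred x | d x == 0].
Proof.
move=> injE ZV extZ dZ Zd h lh hZ.
have [e _ he] := injective_ext_max injE lh (fun _ _ => isT).
have p0 : submod_closed (pred1 (0 : A^o)) := pred1_submod A^o.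
have ks0 : kills (pred1 (0 : A^o)) (s : A^o).
  by move=> r rm; rewrite inE; apply/eqP; apply: ks.
have l0 : linear_on (pred1 (0 : A^o)) (fun _ => 0 : E').
  by move=> c u v _ _; rewrite scaler0 addr0.
(* As d h = 0, m kills d e, so s ↦ d e is well defined on A s, a copy of A/m. The value at 1 of its
   extension to A is an element of Z whose multiple by s is d e. *)
have [|f [lf f0 fs]] := extend_step (b := d e) p0 l0 s0 ks0.
  move=> r rm; rewrite -linearZ -he //.
  by have := hZ r rm; rewrite inE => /eqP->.
have [|g [lg gf gZ]] := extend_linear rA (addgen_submod (s : A^o) p0) ZV extZ lf.
  move=> x /addgenP[c]; rewrite inE subr_eq0 => /eqP->.
  have := lf c (s : A^o) 0 (addgen_gen _ p0) (sub_addgen _ (submod0 p0)).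
  rewrite (f0 0) ?inE // !addr0 fs => ->; exact: submodZ.
have [e' he'] := Zd _ (gZ 1).
have de : d e = d (s *: e').
  rewrite linearZ /= he' -fs -gf; last exact: addgen_gen.
  have g0 : g 0 = 0 by have := lg (-1) 0 0; rewrite !scaleN1r !addNr.
  have := lg s (1 : A^o) 0; rewrite g0 !addr0.
  by move=> <-; rewrite /GRing.scale /= mulr1.
exists (e - s *: e'); first by rewrite inE raddfB /= de subrr.
by move=> r rm; rewrite scalerBr scalerA ks // scale0r subr0 he.
Qed.

(** The image of d i is the kernel of d i.+1, so [ext_max_ker] descends from i.+1 to i, starting
    beyond n where E i = 0. The last kernel, that of d 0, is A itself through eps. *)
Lemma finite_injective_ext_max :
  finite_injective_dimension A^o -> ext_max (predT : {pred A^o}).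
Proof.
move=> [n [E [eps [d [injE eps_inj ex0 exS En]]]]].
have kV i : submod_closed [pred y | d i y == 0].
  split; first by rewrite inE raddf0.
  by move=> c x y; rewrite !inE linearP => /eqP-> /eqP->; rewrite scaler0 addr0.
have ext i : ext_max [pred y | d i y == 0].
  move: {-1}(n.+1 - i)%N (erefl (n.+1 - i)%N) => k; elim: k i => [|k IH] i.
    move=> /eqP ni h lh hZ; exists 0; first by rewrite inE raddf0.
    by move=> r rm; rewrite scaler0; apply: En; rewrite -subn_eq0.
  move=> hk; apply: (ext_max_ker (injE i) (kV i.+1)).
  - apply: IH; rewrite subnS hk //.
  - by move=> x; rewrite inE; apply/eqP/exS; exists x.
  - by move=> z; rewrite inE => /eqP/exS.
move=> h lh _; have lh' : linear_on (m : {pred A^o}) (fun r => eps (h r)).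
  by move=> c u v um vm; rewrite lh // linearP.
have [|z] := ext 0%N _ lh'.
  by move=> r _; rewrite inE; apply/eqP/ex0; exists (h r).
rewrite inE => /eqP/ex0[b <-] hb; exists b => // r rm.
by apply: eps_inj; rewrite hb // linearZ.
Qed.

(** Sending N to 0 and y to s is well defined on N + A y because m kills s; self-injectivity extends
    it to V. *)
Lemma separating_functional (V : lmodType A) (N : {pred V}) y :
  ext_max (predT : {pred A^o}) -> reach (predT : {pred V}) ->
  submod_closed N -> kills N y -> y \notin N ->
  exists f : V -> A^o, [/\ linear f, {in N, forall x, f x = 0} & f y != 0].
Proof.
move=> extA rV NV ky yN.
have l0 : linear_on N (fun _ => 0 : A^o).
  by move=> c u v _ _; rewrite scaler0 addr0.
have [|f [lf f0 fy]] := extend_step (b := s : A^o) NV l0 yN ky.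
  by move=> r rm; rewrite /GRing.scale /= ks.
have [g [lg gf _]] := extend_linear rV (addgen_submod y NV)
  (predT_submod A^o) extA lf (fun _ _ => isT).
exists g; split=> // [x xN|]; last by rewrite gf ?fy //; apply: addgen_gen.
by rewrite gf ?f0 //; apply: sub_addgen.
Qed.

End Extension.
End Local.

(** * Initial forms and initial submodules *)

Lemma last_true (P : nat -> Prop) r : P 0%N -> ~ P r ->
  exists n, P n /\ ~ P n.+1.
Proof.
elim: r => [//|r IH] P0 nP; have [Pr|nPr] := pselect (P r); first by exists r.
exact: IH.
Qed.

Section Initial.
Variables (A : comNzRingType) (a : {pred A}) (M : lmodType A).

Lemma pow0 n : (0 : M) \in powM a n.
Proof. exact: submod0 (powM_submod _ _ _). Qed.
Lemma powD n (x y : M) :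
  x \in powM a n -> y \in powM a n -> x + y \in powM a n.
Proof. exact: submodD (powM_submod _ _ _) _ _. Qed.
Lemma powB n (x y : M) :
  x \in powM a n -> y \in powM a n -> x - y \in powM a n.
Proof. exact: submodB (powM_submod _ _ _) _ _. Qed.
Lemma powZ n c (x : M) : x \in powM a n -> c *: x \in powM a n.
Proof. exact: submodZ (powM_submod _ _ _) _ _. Qed.
Lemma pow_sum n I (s : seq I) (P : pred I) (F : I -> M) :
  (forall i, P i -> F i \in powM a n) ->
  \sum_(i <- s | P i) F i \in powM a n.
Proof. exact: submod_sum (powM_submod _ _ _) _ _ _ _. Qed.

Lemma gr_classB n (x y : M) : x \in powM a n -> y \in powM a n ->
  gr_class a n (x - y) = gr_class a n x - gr_class a n y.
Proof.
move=> hx hy; apply/eqP; rewrite eq_sym subr_eq -gr_classD ?subrK //.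
exact: powB.
Qed.

Lemma gr_class00 n : gr_class a n (0 : M) = 0.
Proof. by apply: gr_class0; apply: pow0. Qed.

Lemma powM_le n k (x : M) : (k <= n)%N -> x \in powM a n -> x \in powM a k.
Proof.
move=> /subnK <-; elim: (n - k)%N => // i IH; rewrite addSn.
by move=> /powM_decr.
Qed.

Lemma gr_compB (x y : gr a M) i : (x - y) i = x i - y i.
Proof. by []. Qed.

Lemma gr_in_fin n (x : M) : exists N, forall i, (N <= i)%N ->
  gr_class a i (if i == n then x else 0) = 0.
Proof.
exists n.+1 => i ni; rewrite gtn_eqF //; exact: gr_class00.
Qed.

(** The class of x placed in degree n, meant for x in a^n M; for other x the default of [gr_class]
    makes it 0. *)
Definition gr_in n (x : M) : gr a M := DirectSum (gr_in_fin n x).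

Lemma gr_in_eq n x : gr_in n x n = gr_class a n x.
Proof. by rewrite /= eqxx. Qed.

Lemma gr_in_neq n x i : i != n -> gr_in n x i = 0.
Proof. by move=> /negPf /= ->; apply: gr_class00. Qed.

Lemma gr_in_pow n x i : x \in powM a n ->
  (if i == n then x else 0 : M) \in powM a i.
Proof. by move=> xn; have [->//|_] := eqVneq i n; apply: pow0. Qed.

Lemma gr_scalerE (c : gr_ring a) (x : gr a M) (u : nat -> A) (v : nat -> M) n :
  (forall i, u i \in @powM A a A^o i) ->
  (forall i, (c : gr a A^o) i = gr_class a i (u i : A^o)) ->
  (forall i, v i \in powM a i) -> (forall i, x i = gr_class a i (v i)) ->
  (c *: x) n = gr_class a n (\sum_(i < n.+1) u i *: v (n - i)%N).
Proof. exact: gr_scaleE. Qed.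

Lemma gr_scaler_pow (u : nat -> A) (v : nat -> M) n :
  (forall i, u i \in @powM A a A^o i) -> (forall i, v i \in powM a i) ->
  \sum_(i < n.+1) u i *: v (n - i)%N \in powM a n.
Proof.
move=> hu hv; apply: pow_sum => -[i /=]; rewrite ltnS => hi _.
exact: (powMZ_sub hi (hu _) (hv _)).
Qed.

(** The sum of the images of the N ∩ a^n M, which is the graded module of N for the filtration
    induced from M. *)
Definition initial (N : {pred M}) : {pred gr a M} :=
  [pred x : gr a M | `[< forall n, exists z,
     [/\ z \in N, z \in powM a n & x n = gr_class a n z] >]].

Lemma initialP N (x : gr a M) : reflect (forall n, exists z,
     [/\ z \in N, z \in powM a n & x n = gr_class a n z]) (x \in initial N).
Proof. exact: asboolP. Qed.

Lemma initial_submod N : submod_closed N -> submod_closed (initial N).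
Proof.
move=> NV; split.
  apply/initialP => n; exists 0; rewrite submod0 // pow0; split=> //.
  by rewrite gr_class00.
move=> c x y /initialP/choice[v hv] /initialP/choice[w hw].
have vP i : v i \in powM a i by case: (hv i).
have wP i : w i \in powM a i by case: (hw i).
pose u i : A := gr_rep ((c : gr a A^o) i).
have uP i : u i \in @powM A a A^o i by apply: gr_rep_pow.
apply/initialP => n; exists (\sum_(i < n.+1) u i *: v (n - i)%N + w n).
have sP := gr_scaler_pow n uP vP; split.
- apply: submodD => //; last by case: (hw n).
  by apply: submod_sum => // i _; apply: submodZ => //; case: (hv (n - i)%N).
- exact: powD.
rewrite gr_classD // dcompD -(gr_scalerE (c := c) (x := x)) //.
- by congr (_ + _); case: (hw n).
- by move=> i; rewrite gr_repK.
- by move=> i; case: (hv i).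
Qed.

Lemma initial0 : initial (pred1 0) = pred1 0.
Proof.
apply/eq_pred/subset_anti => x; last first.
  by rewrite inE => /eqP->; apply: submod0; apply/initial_submod/pred1_submod.
move=> /initialP h; rewrite inE; apply/eqP/direct_sumP => n.
have [z [z0 _ ->]] := h n; move: z0; rewrite inE => /eqP->.
by rewrite gr_class00.
Qed.

Lemma initialT : initial predT = predT.
Proof.
apply/eq_pred/subset_anti => // x _; apply/initialP => n.
by exists (gr_rep (x n)); rewrite gr_rep_pow gr_repK.
Qed.

Lemma initialS (N N' : {pred M}) :
  {subset N <= N'} -> {subset initial N <= initial N'}.
Proof.
move=> sub x /initialP h; apply/initialP => n.
by have [z [/sub z1 z2 z3]] := h n; exists z.
Qed.

End Initial.
Arguments initial {A} a {M} N.
Arguments gr_in {A} a {M} n x.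

(** * Simple quotients give simple quotients of initial submodules *)

Section InitialStep.
Variables (A : comNzRingType) (m a : {pred A}) (M : lmodType A).
Hypotheses (hm : local_ring m) (hN : noetherian_ring A).
Variable r : nat.
Hypothesis ar0 : forall x : M, x \in powM a r -> x = 0.

Definition gr_const (c : A) : gr_ring a := @gr_in A a A^o 0 c.

Lemma gr_const_scale c (x : gr a M) n z : z \in powM a n ->
  x n = gr_class a n z -> (gr_const c *: x) n = gr_class a n (c *: z).
Proof.
move=> zn xz; pose v i := if i == n then z else gr_rep (x i).
have vP i : v i \in powM a i.
  by rewrite /v; have [->//|_] := eqVneq i n; apply: gr_rep_pow.
have vE i : x i = gr_class a i (v i).
  by rewrite /v; have [->//|_] := eqVneq i n; rewrite gr_repK.
rewrite (gr_scalerE (u := fun i => if i == 0%N then c else 0) (v := v)) //.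
  rewrite big_ord_recl /= subn0 big1 ?addr0 /v ?eqxx // => i _.
  by rewrite scale0r.
by move=> i; apply: (@gr_in_pow A a A^o 0%N c i).
Qed.

(** The quotient A/m of N + A y0 by N shows up in a single degree n of the graded module, the last
    one where a^n M contains an element of N + A y0 outside N. *)
Lemma initial_step (N : {pred M}) y0 : submod_closed N -> y0 \notin N ->
  kills m N y0 ->
  [/\ {subset initial a N <= initial a (addgen N y0)},
      ~ (initial a (addgen N y0) =i initial a N) &
      forall S : {pred gr a M}, submod_closed S ->
        {subset initial a N <= S} -> {subset S <= initial a (addgen N y0)} ->
        S =i initial a N \/ S =i initial a (addgen N y0)].
Proof.
move=> NV y0N ky0; have N'V := addgen_submod y0 NV.
pose P n := exists y, [/\ y \in addgen N y0, y \notin N & y \in powM a n].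
(* The search stops because a^r M = 0. *)
have [||n [[y [yN' yN yn]] nP]] := @last_true P r.
- by exists y0; rewrite addgen_gen.
- by move=> [y [_ yN /ar0 y_eq0]]; rewrite y_eq0 submod0 in yN.
have deep z : z \in addgen N y0 -> z \in powM a n.+1 -> z \in N.
  by move=> zN' zn; apply: contraT => zN; case: nP; exists z.
have /addgenP[t ht] := yN'.
have tm : t \notin m.
  apply: contra yN => /ky0 h; rewrite -(subrK (t *: y0) y); exact: submodD.
have [s ts] := local_unit hm hN tm.
have ky : kills m N y.
  move=> b bm; rewrite -(subrK (t *: y0) y) scalerDr; apply: submodD => //.
    exact: submodZ.
  by rewrite scalerA mulrC -scalerA; apply/(submodZ NV)/ky0.
(* Modulo N, y is a unit multiple of y0, so it replaces y0 as generator. *)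
have genY z : z \in addgen N y0 -> exists c, z - c *: y \in N.
  move=> /addgenP[c hc]; exists (c * s).
  have -> : z - (c * s) *: y = z - c *: y0 - (c * s) *: (y - t *: y0).
    by rewrite scalerBr scalerA -mulrA [s * t]mulrC ts mulr1 opprB addrA subrK.
  by apply: submodB => //; apply: submodZ.
pose Y := gr_in a n y.
have YN' : Y \in initial a (addgen N y0).
  apply/initialP => i; exists (if i == n then y else 0).
  rewrite gr_in_pow //; split=> //; case: ifP => // _; exact: submod0.
(* The coefficient c is read off in degree n. Above n, [deep] applies; below n, a lift may be
   corrected by a multiple of y, which lies in a^(i+1) M and leaves the class unchanged. *)
have split_off w : w \in initial a (addgen N y0) ->
    exists c, w - gr_const c *: Y \in initial a N.
  move=> /initialP hw; have [z [zN' zn wz]] := hw n.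
  have [c hc] := genY z zN'; exists c; apply/initialP => i.
  have Yi : (w - gr_const c *: Y) i =
      w i - gr_class a i (c *: (if i == n then y else 0)).
    by rewrite gr_compB (gr_const_scale _ (z := if i == n then y else 0)) ?gr_in_pow.
  have dP := gr_in_pow i yn.
  rewrite Yi; have [z' [z'N' z'i wz']] := hw i.
  have [ei|ni] := eqVneq i n.
    subst i; rewrite eqxx in dP *; exists (z - c *: y).
    by split=> //; rewrite ?powB ?powZ // gr_classB ?powZ // wz.
  rewrite scaler0 gr_class00 subr0; have [in_|] := ltnP i n.
    have [d hd] := genY z' z'N'; exists (z' - d *: y).
    have yi : y \in powM a i.+1 by apply: powM_le yn.
    split=> //; first by apply: powB; rewrite // powZ // (powM_le _ yn) // ltnW.
    rewrite wz'; apply/gr_class_eq => //.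
      by apply: powB; rewrite // powZ // (powM_le _ yn) // ltnW.
    by rewrite opprB addrC subrK powZ.
  rewrite leq_eqVlt eq_sym (negPf ni) => ni'.
  by exists z'; split=> //; apply: deep => //; apply: powM_le z'i.
have cN c : c \in m -> gr_const c *: Y \in initial a N.
  move=> cm; apply/initialP => i; exists (c *: (if i == n then y else 0)).
  rewrite powZ ?gr_in_pow // (gr_const_scale _ (z := if i == n then y else 0)) //.
    split=> //; case: ifP => _; first exact: ky.
    by rewrite scaler0 submod0.
  exact: gr_in_pow.
have YN : Y \notin initial a N.
  apply/initialP => /(_ n)[z [zN zn]]; rewrite gr_in_eq.
  move/(gr_class_eq yn zn) => yz; case/negP: yN.
  rewrite -(subrK z y); apply: submodD => //; apply: deep => //.
  by apply: submodB => //; apply: sub_addgen.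
split; first exact/initialS/sub_addgen.
  by move=> /(_ Y); rewrite YN' (negPf YN).
move=> S SV NS SN'.
(* An element w of S outside [initial a N] is c Y modulo it with c outside m. So c is a unit and Y
   lies in S. *)
have [SN|/existsNP[w]] := pselect {subset S <= initial a N}.
  by left; apply: subset_anti.
move=> /not_implyP[wS /negP wN]; right; apply: subset_anti => // w' w'N'.
have [c hc] := split_off w (SN' _ wS).
have cm : c \notin m.
  apply: contra wN => /cN h; rewrite -(subrK (gr_const c *: Y) w).
  by apply: submodD => //; apply: initial_submod.
have [b cb] := local_unit hm hN cm.
have YS : Y \in S.
  have -> : Y = gr_const b *: (gr_const c *: Y).
    apply/direct_sumP => i; have dP := gr_in_pow i yn.
    have h1 := gr_const_scale c dP (erefl : Y i = _).
    rewrite (gr_const_scale b (powZ c dP) h1).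
    by rewrite scalerA mulrC cb scale1r.
  apply: submodZ => //; have -> : gr_const c *: Y = w - (w - gr_const c *: Y).
    by rewrite opprB addrC subrK.
  by apply: submodB => //; apply: NS.
have [d hd] := split_off w' w'N'.
rewrite -(subrK (gr_const d *: Y) w'); apply: submodD; rewrite ?submodZ //.
exact: NS.
Qed.

End InitialStep.

Arguments powM : simpl never.
Lemma linear_pack (R : pzRingType) (V E : lmodType R) (f : V -> E) :
  linear f -> exists g : {linear V -> E}, forall x, g x = f x.
Proof.
move=> lf.
by exists (HB.pack f (GRing.isLinear.Build _ _ _ _ f lf) : {linear V -> E}).
Qed.

(** * Symbols of functionals and strict chains in the graded Hom *)

Section StarHomSide.
Variables (A : comNzRingType) (a : {pred A}) (M : lmodType A) (r : nat).
Hypotheses (aM0 : forall x : M, x \in powM a r -> x = 0).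
Hypotheses (aA0 : forall x : A^o, x \in powM a r -> x = 0).

(** Terms with j > p vanish in the first sum, and terms with j > k lie in a^(k+1) V because u j is
    in a^j. This compares products formed in different degrees. *)
Lemma truncated_sum (V : lmodType A) (u : nat -> A) (v e : nat -> V) k p :
  (forall i, u i \in @powM A a A^o i) ->
  (forall j, (j <= k)%N -> v j = if (j <= p)%N then e j else 0) ->
  \sum_(j < k.+1) u j *: v j - \sum_(j < p.+1) u j *: e j \in powM a k.+1.
Proof.
move=> hu vE.
have -> : \sum_(j < k.+1) u j *: v j =
    \sum_(j < k.+1) u j *: (if (j <= p)%N then e j else 0).
  by apply: eq_bigr => j _; rewrite vE // -ltnS.
have [kp|pk] := leqP k p.
  rewrite -(big_mkord predT (fun j => u j *: (if (j <= p)%N then e j else 0))).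
  rewrite -(big_mkord predT (fun j => u j *: e j)) /=.
  have -> : \sum_(0 <= j < k.+1) u j *: (if (j <= p)%N then e j else 0) =
      \sum_(0 <= j < k.+1) u j *: e j.
    by apply: eq_big_nat => j /andP[_ jk]; rewrite ifT //; lia.
  rewrite [X in _ - X](@big_cat_nat _ _ _ k.+1) //=.
  rewrite opprD addrA subrr add0r; apply: (submodN (powM_submod _ _ _)).
  rewrite big_nat; apply: pow_sum => j /andP[kj _].
  apply: (powM_le (n := j + 0)); first by rewrite addn0.
  exact: powMZ.
rewrite -(subrr (0 : V)) subr0.
suff -> : \sum_(j < k.+1) u j *: (if (j <= p)%N then e j else 0) =
  \sum_(j < p.+1) u j *: e j by rewrite subrr pow0.
rewrite (big_ord_widen k.+1 (fun j => u j *: e j)); last by lia.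
rewrite [RHS]big_mkcond; apply: eq_bigr => j _ /=.
by rewrite ltnS; case: ifP => // _; rewrite scaler0.
Qed.

(* Maps sending a^n M to a^(n + p - r) for all n; the shift by [r] makes every
   relevant degree p - r a natural number p. *)
Definition shifts p (f : M -> A^o) := forall n k x, (k + r <= n + p)%N ->
  x \in powM a n -> f x \in powM a k.

Lemma gr_map_fin p (f : {linear M -> A^o}) (hf : shifts p f) (x : gr a M) :
  exists N, forall k, (N <= k)%N ->
    gr_class a k (if (p <= k + r)%N then f (gr_rep (x (k + r - p)%N)) else 0) = 0.
Proof.
exists r => k rk; case: ifP => [pk|_]; last exact: gr_class00.
rewrite (aA0 (x := f _)) ?gr_class00 //; apply: (powM_le rk).
by apply: (hf _ _ _ _ (gr_rep_pow _)); lia.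
Qed.

(** The symbol of f, homogeneous of degree p - r; the test [p <= k + r] in its components excludes
    negative source degrees. *)
Definition gr_map p (f : {linear M -> A^o}) (hf : shifts p f) (x : gr a M) :
  gr a A^o := DirectSum (gr_map_fin hf x).

(** Since f sends a^(n+1) M into a^(k+1), the class of f v depends only on that of v. *)
Lemma gr_mapE p (f : {linear M -> A^o}) (hf : shifts p f) (x : gr a M) n k v :
  (k + r = n + p)%N -> v \in powM a n -> x n = gr_class a n v ->
  gr_map hf x k = gr_class a k (f v).
Proof.
move=> e vn xv; rewrite /=; have -> : (p <= k + r)%N by lia.
have -> : (k + r - p = n)%N by lia.
apply/gr_class_eq.
- by apply: (hf _ _ _ _ (gr_rep_pow _)); lia.
- by apply: (hf _ _ _ _ vn); lia.
rewrite -raddfB; apply: (hf n.+1); first by lia.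
by apply/gr_class_eq; rewrite ?gr_rep_pow // gr_repK.
Qed.

Lemma gr_map_lt p (f : {linear M -> A^o}) (hf : shifts p f) (x : gr a M) k :
  (k + r < p)%N -> gr_map hf x k = 0.
Proof. by move=> kp; rewrite /= leqNgt kp gr_class00. Qed.

Lemma gr_map_linear p (f : {linear M -> A^o}) (hf : shifts p f) :
  linear (gr_map hf : gr a M -> gr a A^o).
Proof.
move=> c x y; apply: direct_sumP => k; rewrite dcompD.
pose u i : A := gr_rep ((c : gr a A^o) i); pose v i := gr_rep (x i).
have uP i : u i \in @powM A a A^o i by apply: gr_rep_pow.
have uE i : (c : gr a A^o) i = gr_class a i (u i : A^o) by rewrite gr_repK.
have vP i : v i \in powM a i by apply: gr_rep_pow.
have vE i : x i = gr_class a i (v i) by rewrite gr_repK.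
pose v' i : A^o := if (p <= i + r)%N then f (v (i + r - p)%N) else 0.
have v'P i : v' i \in powM a i.
  by rewrite /v'; case: ifP => pi; [apply: (hf _ _ _ _ (vP _)); lia|apply: pow0].
have v'E i : gr_map hf x i = gr_class a i (v' i) by [].
rewrite (gr_scalerE k uP uE v'P v'E).
have [pk|kp] := leqP p (k + r); last first.
  rewrite !gr_map_lt // addr0 big1 ?gr_class00 // => i _.
  by rewrite /v' ifF ?scaler0 //; lia.
pose n := (k + r - p)%N; have e : (k + r = n + p)%N by rewrite /n; lia.
have wP := gr_rep_pow (y n); set w := gr_rep _ in wP.
have sP := gr_scaler_pow n uP vP.
rewrite (gr_mapE hf e (v := \sum_(i < n.+1) u i *: v (n - i)%N + w)); last first.
- by rewrite dcompD (gr_scalerE n uP uE vP vE) gr_classD // gr_repK.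
- exact: powD.
rewrite (gr_mapE hf e wP) ?gr_repK // linearD gr_classD; last 2 first.
- by apply: (hf _ _ _ _ sP); lia.
- by apply: (hf _ _ _ _ wP); lia.
congr (_ + _); symmetry.
apply/gr_class_eq; first exact: gr_scaler_pow.
  by apply: (hf _ _ _ _ sP); lia.
have -> : f (\sum_(i < n.+1) u i *: v (n - i)%N) =
    \sum_(i < n.+1) u i *: f (v (n - i)%N).
  by rewrite linear_sum; apply: eq_bigr => i _; rewrite linearZ.
(* Multiplying before f sums up to degree n, multiplying after f up to degree k. *)
apply: (truncated_sum (v := fun j => v' (k - j)%N)
  (e := fun j => f (v (n - j)%N))) => // j jk.
rewrite /v'; have -> : (p <= k - j + r)%N = (j <= n)%N by rewrite /n; lia.
by case: ifP => // nj; congr (f (v _)); rewrite /n; lia.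
Qed.

Lemma gr_map_star p (f : {linear M -> A^o}) (hf : shifts p f) :
  exists phi : starHom a M A^o, val phi = gr_map hf.
Proof.
have h : (gr_map hf : gr a M -> gr a A^o) \in @gr_star_hom A a M A^o.
  apply/star_homP; exists [:: (p%:Z - r%:Z, gr_map hf : gr a M -> gr a A^o)].
  split; last first.
    rewrite big_cons big_nil; apply: funext => x.
    exact: esym (addr0 (gr_map hf x)).
  move=> _ /[1!inE] /eqP-> /=; split; first exact: gr_map_linear.
  move=> i x /gr_homogP xi; apply/gr_homogP => k.
  have [pk|kp] := leqP p (k + r); last by rewrite gr_map_lt ?eqxx.
  have e : (k + r = k + r - p + p)%N by lia.
  have [x0|/xi <- _] := eqVneq (x (k + r - p)%N) 0; last by lia.
  rewrite (gr_mapE hf e (pow0 _ _ _)) ?raddf0 ?gr_class00 ?eqxx //.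
by exists (exist (fun g => g \in gr_star_hom (N := A^o)) (gr_map hf) h : starHom a M A^o).
Qed.

(* The initial submodule of the annihilator of [N] in Hom_A(M, A). *)
Definition star_annih (N : {pred M}) : {pred starHom a M A^o} :=
  [pred phi : starHom a M A^o | `[< forall p, exists f : {linear M -> A^o},
    [/\ {in N, forall x, f x = 0}, shifts p f &
      forall n k x, (k + r = n + p)%N -> x \in powM a n ->
        (val phi) (gr_in a n x) k = gr_class a k (f x)] >]].

Lemma star_annihP N (phi : starHom a M A^o) : reflect
  (forall p, exists f : {linear M -> A^o},
    [/\ {in N, forall x, f x = 0}, shifts p f &
      forall n k x, (k + r = n + p)%N -> x \in powM a n ->
        (val phi) (gr_in a n x) k = gr_class a k (f x)]) (phi \in star_annih N).
Proof. exact: asboolP. Qed.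

Lemma shifts0 p : shifts p (fun _ => 0).
Proof. by move=> n k x _ _; apply: pow0. Qed.

Lemma star_annih_submod N : submod_closed (star_annih N).
Proof.
split.
  apply/star_annihP => p; exists \0; split=> //; first exact: shifts0.
  by move=> n k x _ _; rewrite gr_class00.
move=> c phi psi /star_annihP/choice[f hf] /star_annihP/choice[g hg].
apply/star_annihP => p.
pose u i : A := gr_rep ((c : gr a A^o) i).
have uP i : u i \in @powM A a A^o i by apply: gr_rep_pow.
have uE i : (c : gr a A^o) i = gr_class a i (u i : A^o) by rewrite gr_repK.
(* The part of c phi with index p: u j raises the filtration by j, and f (p - j) by p - j - r. *)
pose s x : A^o := \sum_(j < p.+1) u j *: f (p - j)%N x.
have [|h hE] := @linear_pack _ M A^o (fun x => s x + g p x).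
  move=> b x y; rewrite /s linearP scalerDr addrACA; congr (_ + _).
  rewrite scaler_sumr -big_split; apply: eq_bigr => j _ /=.
  by rewrite linearP scalerDr !scalerA mulrC.
have sS : shifts p s.
  move=> n k x e xn; apply: pow_sum => j _; have := ltn_ord j; rewrite ltnS => jp.
  have [jk|kj] := leqP j k.
    apply: (powMZ_sub jk) => //; case: (hf (p - j)%N) => _ h' _.
    by apply: (h' _ _ _ _ xn); lia.
  apply: (powM_le (n := j + 0)); first by lia.
  exact: powMZ.
exists h; split.
- move=> x xN; rewrite hE; case: (hg p) => -> // _ _; rewrite addr0.
  apply: big1 => j _; case: (hf (p - j)%N) => -> // _ _; exact: scaler0.
- move=> n k x e xn; rewrite hE; apply: powD; first exact: sS e xn.
  by case: (hg p) => _ h' _; apply: h' e xn.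
move=> n k x e xn; rewrite hE gr_classD; last 2 first.
- by apply: (sS _ _ _ _ xn); lia.
- by case: (hg p) => _ h' _; apply: (h' _ _ _ _ xn); lia.
pose v i : A^o := if (n <= i + r)%N then f (i + r - n)%N x else 0.
have vP i : v i \in powM a i.
  rewrite /v; case: ifP => ni; last exact: pow0.
  by case: (hf (i + r - n)%N) => _ h' _; apply: (h' _ _ _ _ xn); lia.
have vE i : (val phi) (gr_in a n x) i = gr_class a i (v i).
  rewrite /v; case: leqP => ni.
    by case: (hf (i + r - n)%N) => _ _ -> //; lia.
  (* Here n > i + r forces x = 0. Zero is the same in every degree, so the witness of index i + r
     applies with source degree 0. *)
  have -> : x = 0 by apply/aM0/(powM_le _ xn); lia.
  have -> : gr_in a n (0 : M) = gr_in a 0 0.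
    by apply: direct_sumP => j /=; rewrite !if_same.
  by case: (hf (i + r)%N) => _ _ ->; rewrite ?raddf0 ?pow0.
have -> : (val (c *: phi + psi)) (gr_in a n x) k =
    (c *: (val phi) (gr_in a n x)) k + (val psi) (gr_in a n x) k by [].
congr (_ + _); last first.
  by case: (hg p) => _ _ ->.
rewrite (gr_scalerE k uP uE vP vE).
apply/gr_class_eq; first exact: gr_scaler_pow.
  by apply: (sS _ _ _ _ xn); lia.
apply: (truncated_sum (v := fun j => v (k - j)%N)
  (e := fun j => f (p - j)%N x)) => // j jk.
rewrite /v; have -> : (n <= k - j + r)%N = (j <= p)%N by lia.
by case: ifP => // jp; congr (f _ x); lia.
Qed.

Lemma star_annihS (N N' : {pred M}) :
  {subset N <= N'} -> {subset star_annih N' <= star_annih N}.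
Proof.
move=> sub phi /star_annihP h; apply/star_annihP => p.
have [f [f0 fs fE]] := h p; exists f; split=> // x /sub; exact: f0.
Qed.

(** Among functionals killing N but not N', one with the last possible shift is chosen. Its symbol
    cannot come from a functional killing N', since subtracting that one would shift further. *)
Lemma star_annih_strict (N N' : {pred M}) y (f : {linear M -> A^o}) :
  {subset N <= N'} -> {in N, forall x, f x = 0} -> y \in N' -> f y != 0 ->
  ~ (star_annih N =i star_annih N').
Proof.
move=> sub fN yN' fy.
pose P p := exists f : {linear M -> A^o},
  [/\ {in N, forall x, f x = 0}, exists2 y, y \in N' & f y != 0 & shifts p f].
(* Every functional satisfies [shifts 0] because a^r M = 0, and only zero satisfies [shifts (r + r)]
   because a^r A = 0. *)
have [||p [[{fy yN'}g [gN [{}y yN' gy] gs]] nP]] := @last_true P (r + r).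
- exists f; split=> //; first by exists y.
  move=> n k x nk xn; have -> : x = 0 by apply/aM0/(powM_le _ xn); lia.
  by rewrite raddf0 pow0.
- move=> [g [gN [z _ gz] gs]]; case/eqP: gz; apply: aA0.
  by apply: (gs 0%N); rewrite ?leqnn.
have [phi phiE] := gr_map_star gs.
move=> /(_ phi); suff -> : phi \in star_annih N.
  move/esym/star_annihP => /(_ p)[h [hN' hs hE]]; apply: nP.
  exists (g \- h); split.
  - by move=> x xN /=; rewrite gN // hN' ?subr0 //; apply: sub.
  - by exists y => //=; rewrite hN' ?subr0.
  move=> n [|k] x e xn //=.
  (* When k + r < p both maps already land in a^(p-r), inside a^(k+1). Otherwise their symbols agree
     in degree k. *)
  have [pk|kp] := leqP p (k + r); last first.
    apply: powB; apply: (powM_le (n := (p - r)%N)); try lia.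
      by apply: (gs 0%N) => //; lia.
    by apply: (hs 0%N) => //; lia.
  have e' : (k + r = k + r - p + p)%N by lia.
  have xn' : x \in powM a (k + r - p) by apply: powM_le xn; lia.
  apply/gr_class_eq; [by apply: (gs _ _ _ _ xn'); lia|by apply: (hs _ _ _ _ xn'); lia|].
  by rewrite -(hE _ _ _ e' xn') phiE (gr_mapE gs e' xn') // gr_in_eq.
(* The symbol of g is homogeneous, so for every index other than p the zero functional represents
   it. *)
apply/star_annihP => q; have [->|qp] := eqVneq q p.
  exists g; split=> // n k x e xn.
  by rewrite phiE (gr_mapE gs e xn) // gr_in_eq.
exists \0; split=> //; first exact: shifts0.
move=> n k x e xn; rewrite gr_class00 phiE.
have [pk|kp] := leqP p (k + r); last by rewrite gr_map_lt.
have e' : (k + r = k + r - p + p)%N by lia.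
rewrite (gr_mapE gs e' (pow0 _ _ _)) ?raddf0 ?gr_class00 //.
by rewrite gr_in_neq //; lia.
Qed.

End StarHomSide.

(** * Comparison of the two lengths *)

Lemma module_length_le (R R' : pzRingType) (V : lmodType R) (W : lmodType R')
    L (C : nat -> {pred V}) :
  composition_series L C ->
  (forall n (D : nat -> {pred W}), composition_series n D -> (L <= n)%N) ->
  (module_length V <= module_length W)%E.
Proof.
move=> hC hD; rewrite /module_length.
(* The length is a minimum: one series of V bounds it above, while every series of W has to be
   considered; without any, the length of W is [+oo]. *)
case: pselect => [hV|]; last by case; exists L; apply/asboolP; exists C.
case: pselect => [hW|_]; last exact: leey.
rewrite lee_fin lez_nat; case: ex_minnP => i _ mini; case: ex_minnP => j.
move=> /asboolP[D /hD Lj] _; apply: leq_trans Lj; apply: mini.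
by apply/asboolP; exists C.
Qed.

Theorem corollary4p7 (A : comNzRingType) (m a : {pred A}) (M : lmodType A)
  (hlocal : local_ring m) (hartinian : artinian_ring A)
  (hgorenstein : gorenstein_local_ring m)
  (ha : idealr_closed a)
  (hM : fin_gen_module M) :
  (module_length (gr a M) <= module_length (starHom a M A^o))%E.
Proof.
have [_ noeth injdim] := hgorenstein.
have rA := reach_noetherian hlocal noeth hartinian noeth.
have rM := reach_fin_gen rA hM.
have am := proper_sub_max hlocal noeth ha.
have [rm rmP] := powM_eq0 am rM; have [ra raP] := powM_eq0 am rA.
(* A common exponent killing both M and A. *)
pose r := maxn rm ra.
have aM0 (x : M) : x \in powM a r -> x = 0.
  by move=> /(powM_le (leq_maxl _ _)); apply: rmP.
have aA0 (x : A^o) : x \in powM a r -> x = 0.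
  by move=> /(powM_le (leq_maxr _ _)); apply: raP.
have [|s s0 ks0] := exists_socle hlocal noeth hartinian (x := 1 : A^o)
  (pred1_submod A^o); first by rewrite inE oner_neq0.
have ks : {in m, forall t, t * s = 0} by move=> t tm; apply/eqP/ks0.
have extA := finite_injective_ext_max hlocal noeth s0 ks rA injdim.
have [L [F [FV F0 FL FS]]] := reach_flag rM.
apply: (@module_length_le _ _ _ _ L (fun i => initial a (F i))).
  split=> [i|||i iL]; first exact: initial_submod.
  - by rewrite F0 initial0.
  - by rewrite FL initialT.
  have [y [yF ky ->]] := FS i iL.
  exact: (initial_step hlocal noeth rmP (FV i) yF ky).
move=> n D hD.
(* Annihilators reverse inclusions, so the flag is read backwards to obtain an ascending chain of
   length L. *)
apply: (chain_le_composition_series (K := fun i => star_annih r (F (L - i)%N)) hD).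
  by move=> i _; apply: star_annih_submod.
move=> i iL; have [|y [yF ky FE]] := FS (L - i.+1)%N; first by lia.
have e : (L - i = (L - i.+1).+1)%N by lia.
rewrite e FE; have sub := @sub_addgen _ _ (F (L - i.+1)%N) y.
split; first exact: star_annihS.
have [f [lf fN fy]] := separating_functional hlocal noeth s0 ks extA rM (FV _) ky yF.
have [g gE] := linear_pack lf.
apply: (star_annih_strict aM0 aA0 (f := g) (y := y)) => //.
- by move=> x xN; rewrite gE fN.
- exact: addgen_gen.
- by rewrite gE.
Qed.
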